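(* Let $1\le p<\infty$, let $T:\mathcal V(\mathbb{R}^n)\to\mathcal V(\mathbb{R}^n)$ be a rearrangement and let $\mathcal W$ be a family of rearrangements from $\mathcal V(\mathbb{R}^n)$ to $\mathcal V(\mathbb{R}^n)$. The following are equivalent: (i) $T$ is approximable in $L^p$ on $L^p_+(\mathbb{R}^n)$ by maps in $\mathcal W$; (ii) $\diamond_T$ is approximable on $\mathcal L^n$ by maps in $\{\diamond_W:W\in\mathcal W\}$; (iii) $\diamond_T$ is approximable on $\mathcal C^n$ by maps in $\{\diamond_W:W\in\mathcal W\}$. The equivalence remains true if ''approximable'' is replaced throughout by ''sequentially approximable''. Moreover, (i)$\Rightarrow$(ii)$\Leftrightarrow$(iii) also holds with ''approximable'' replaced throughout by ''weakly approximable''.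
   Context: $\mathcal V(\mathbb{R}^n)$: nonnegative measurable $f$ on $\mathbb{R}^n$ with $\mathcal H^n(\{f>t\})<\infty$ for all $t>0$. A rearrangement is a map $T$ that is equimeasurable ($\mathcal H^n(\{Tf>t\})=\mathcal H^n(\{f>t\})$ for all $t$) and monotonic ($f\le g$ a.e. implies $Tf\le Tg$ a.e.). $\mathcal L^n$: measurable sets of finite measure; $\mathcal C^n$: nonempty compact sets. The induced set map is $\diamond_TA=\{x:T1_A(x)=1\}$. For maps on functions: $T$ is approximable in $L^p$ on $X$ by $\mathcal W$ if there are $T_k\in\mathcal W$ with $\|T_kf-Tf\|_p\to0$ for all $f\in X$; weakly approximable if the $T_k$ may depend on $f$; sequentially approximable if $T_k=S_k\circ\cdots\circ S_1$ for a fixed sequence $(S_k)$ in $\mathcal W$. For set maps the same notions are defined with $\|1_{\diamond_kA}-1_{\diamond A}\|_1\to0$ for all $A$ in the class. *)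

(* Defs.v *)
From HB Require Import structures.
From mathcomp Require Import all_boot all_order all_algebra.
From mathcomp Require Import all_classical all_reals all_analysis.
Set Implicit Arguments. Unset Strict Implicit. Unset Printing Implicit Defensive.
Import Order.TTheory GRing.Theory Num.Theory.
Import numFieldNormedType.Exports.
Local Open Scope classical_set_scope.
Local Open Scope ring_scope.

Section LebesgueRn.
Variables (R : realType) (n : nat).

Definition hobox (a b : 'rV[R]_n) : set 'rV[R]_n :=
  [set x | forall i : 'I_n, a ord0 i <= x ord0 i < b ord0 i].

Definition boxes : set (set 'rV[R]_n) :=
  [set B | exists a b, B = hobox a b].

(* the sigma-algebra generated by boxes (Borel sets); only used as the
   semiring of admissible covers below *)
Definition RnB := g_sigma_algebraType boxes.

Definition box_volume (a b : 'rV[R]_n) : R :=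
  \prod_(i < n) Num.max (b ord0 i - a ord0 i) 0.

(* volume of a box; +oo on sets that are not boxes (so that covers in
   mu_ext effectively range over covers by boxes) *)
Definition box_vol (A : set RnB) : \bar R :=
  if `[< A = set0 >] then 0%E
  else ereal_inf [set v | (exists a b, A = hobox a b /\ v = (box_volume a b)%:E)
                          \/ v = +oo%E].

Lemma box_vol0 : box_vol set0 = 0%E.
Proof. by rewrite /box_vol asboolT. Qed.

Lemma box_vol_ge0 A : (0 <= box_vol A)%E.
Proof.
rewrite /box_vol; case: ifPn => // _.
apply: le_ereal_inf_tmp => v [[a [b [_ ->]]]|->]; last exact: leey.
rewrite lee_fin /box_volume; apply: prodr_ge0 => i _.
by rewrite le_max lexx orbT.
Qed.

Definition leb_outer : set RnB -> \bar R := mu_ext box_vol.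

HB.instance Definition _ := isOuterMeasure.Build R RnB leb_outer
  (mu_ext0 box_vol0 box_vol_ge0) (mu_ext_ge0 box_vol_ge0)
  (le_mu_ext box_vol) (mu_ext_sigma_subadditive box_vol_ge0).

Definition lebo : {outer_measure set RnB -> \bar R} := leb_outer.
Definition Leb := caratheodory_type lebo.

Definition lam : {measure set Leb -> \bar R} := (lebo : set Leb -> \bar R).

End LebesgueRn.

Arguments lam {R n}.

Section Rearrangements.
Variables (R : realType) (n : nat).
Local Notation E := (Leb R n).
Local Open Scope ereal_scope.

Definition inV (f : E -> R) : Prop :=
  [/\ (forall x, (0 <= f x)%R), measurable_fun setT f &
      forall t : R, (0 < t)%R -> lam [set x | (t < f x)%R] < +oo].

Definition equimeasurable (T : (E -> R) -> (E -> R)) : Prop :=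
  forall f, inV f -> forall t : R,
    lam [set x | (t < T f x)%R] = lam [set x | (t < f x)%R].

Definition monotonic (T : (E -> R) -> (E -> R)) : Prop :=
  forall f g, inV f -> inV g ->
    {ae lam, forall x, (f x <= g x)%R} ->
    {ae lam, forall x, (T f x <= T g x)%R}.

(* a rearrangement V(R^n) -> V(R^n) (values outside V are irrelevant) *)
Definition rearrangement (T : (E -> R) -> (E -> R)) : Prop :=
  [/\ forall f, inV f -> inV (T f), equimeasurable T & monotonic T].

Definition diamond (T : (E -> R) -> (E -> R)) (A : set E) : set E :=
  [set x | T (\1_A) x = 1%R].

Definition Lp_plus (p : R) (f : E -> R) : Prop :=
  [/\ (forall x, (0 <= f x)%R), measurable_fun setT f &
      'N[lam]_p%:E[EFin \o f] < +oo].

Definition Lclass (A : set E) : Prop := measurable A /\ lam A < +oo.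

Definition Cclass (A : set E) : Prop :=
  A !=set0 /\ @compact 'rV[R]_n A.

Definition dLp (p : R) (f g : E -> R) : \bar R := 'N[lam]_p%:E[EFin \o (f \- g)%R].
Definition dset (A B : set E) : \bar R :=
  'N[lam]_1%:E[EFin \o (\1_A \- \1_B)%R].

End Rearrangements.

Section Approx.
Variables (R : realType) (U : Type) (d : U -> U -> \bar R).
Local Open Scope ereal_scope.

Definition approximable (X : set U) (W : set (U -> U)) (T : U -> U) : Prop :=
  exists Tk : nat -> (U -> U), (forall k, W (Tk k)) /\
    forall f, X f -> d (Tk k f) (T f) @[k --> \oo] --> 0.

Definition weakly_approximable (X : set U) (W : set (U -> U)) (T : U -> U)
  : Prop :=
  forall f, X f -> exists Tk : nat -> (U -> U), (forall k, W (Tk k)) /\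
    d (Tk k f) (T f) @[k --> \oo] --> 0.

Fixpoint compn (S : nat -> (U -> U)) (k : nat) : U -> U :=
  match k with 0 => id | k'.+1 => S k' \o compn S k' end.

Definition seq_approximable (X : set U) (W : set (U -> U)) (T : U -> U)
  : Prop :=
  exists S : nat -> (U -> U), (forall k, W (S k)) /\
    forall f, X f -> d (compn S k.+1 f) (T f) @[k --> \oo] --> 0.

End Approx.

Arguments inV {R n}.
Arguments Lclass {R n}.
Arguments Cclass {R n}.
Arguments dset {R n}.
Arguments dLp {R n}.
Arguments Lp_plus {R n}.
Arguments diamond {R n}.
Arguments rearrangement {R n}.

(* Main.v *)
(* A rearrangement [T] acts on superlevel sets: for [c > 0], the set [T f >= c]
   agrees up to a null set with [diamond T] of the set [f >= c].  Indeed
   [c 1_A <= f] with [A] the set [f >= c] gives, by monotonicity, one inclusion,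
   and both sides have the same finite measure.

   (ii) => (i): [|u - v|^p <= |u^p - v^p|] reduces to the L^1 distance of
   [u^p] and [v^p], where [u = S f] and [v = T f].  Replacing both by a step
   function with finitely many levels costs a remainder that depends only on the
   distribution of [f^p], hence not on [S], and the distance of the step functions
   is a finite sum of symmetric differences of sets [diamond S A], [diamond T A].

   (iii) => (ii): inner regularity, since [diamond T] preserves the measure of
   the difference of two nested sets.

   Sequential approximation reduces to approximation by the fixed sequence of
   compositions, because composing diamonds or taking the diamond of a composition
   gives the same set up to a null set. *)

Require Import Defs.
From HB Require Import structures.
From mathcomp Require Import all_boot all_order all_algebra.
From mathcomp Require Import all_classical all_reals all_analysis.
From mathcomp Require Import measurable_realfun ring lra.
Set Implicit Arguments. Unset Strict Implicit. Unset Printing Implicit Defensive.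
Import Order.TTheory GRing.Theory Num.Theory.
Import numFieldNormedType.Exports.
Local Open Scope classical_set_scope.
Local Open Scope ring_scope.

(** * Carathéodory measurability of boxes, open sets and closed sets *)

Section BoxMeasure.
Context (R : realType) (n : nat).
Local Notation E := (Leb R n).
Implicit Types (a b : 'rV[R]_n) (i : 'I_n) (c : R).
Local Open Scope ereal_scope.

Lemma hobox_RnB_measurable a b : measurable (hobox a b : set (RnB R n)).
Proof. by apply: sub_sigma_algebra; exists a, b. Qed.

(** The sequence consisting of [A] followed by empty sets is an admissible cover of [A]. *)
Lemma lebo_le_box_vol (A : set (RnB R n)) :
  measurable A -> lebo R n A <= box_vol A.
Proof.
move=> mA; apply: ereal_inf_lbound; exists (fun k => if k is 0%N then A else set0).
  by split=> [[|k]//|x Ax]; exists 0%N.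
apply/cvg_lim => //; rewrite -cvg_shiftS.
rewrite (_ : [sequence _]_n = cst (box_vol A)); first exact: cvg_cst.
by rewrite funeqE => k /=; rewrite big_nat_recl//= big1 ?adde0// => j _; rewrite box_vol0.
Qed.

Lemma lebo_hobox_le a b : lebo R n (hobox a b) <= (box_volume a b)%:E.
Proof.
apply: (le_trans (lebo_le_box_vol (hobox_RnB_measurable a b))).
rewrite /box_vol; case: ifPn => _.
  by rewrite lee_fin prodr_ge0// => i _; rewrite le_max lexx orbT.
by apply: ereal_inf_lbound; left; exists a, b.
Qed.

(** The identity needs no condition on [c]: when the cut misses the box, one of the two pieces has a
    side that [Num.max] clips to length 0. *)
Lemma box_volume_split a b i c :
  (box_volume a (\row_j if j == i then Num.min (b ord0 j) c else b ord0 j) +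
   box_volume (\row_j if j == i then Num.max (a ord0 j) c else a ord0 j) b
   = box_volume a b)%R.
Proof.
rewrite /box_volume (bigD1 i)//= (bigD1 (P:=xpredT) i)//= [RHS](bigD1 i)//= !mxE eqxx.
under eq_bigr => j /negbTE ji do rewrite mxE ji.
rewrite [X in (_ + _ * X)%R](eq_bigr (fun j => Num.max (b ord0 j - a ord0 j) 0)%R); last first.
  by move=> j /negbTE ji; rewrite mxE ji.
rewrite -mulrDl; congr (_ * _)%R; rewrite !maxEle !minEle.
by repeat case: ifPn => //=; rewrite -?ltNge; lra.
Qed.

(* A half-space cuts a box into two boxes whose volumes add up. *)
Lemma halfspace_measurable i c :
  measurable ([set x | (x ord0 i < c)%R] : set E).
Proof.
apply: (@le_caratheodory_measurable _ _ (lebo R n)) => X.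
pose H : set 'rV[R]_n := [set x | (x ord0 i < c)%R].
rewrite -[leLHS]/(lebo R n (X `&` H) + lebo R n (X `&` ~` H)).
(* It suffices to treat the members of a cover of [X] one at a time and sum. On a nonempty set that
   is not a box [box_vol] is [+oo], so only boxes need an argument. *)
have key B : lebo R n (B `&` H) + lebo R n (B `&` ~` H) <= box_vol B.
  have [->|B0] := eqVneq B set0.
    by rewrite !set0I outer_measure0 box_vol0 adde0.
  rewrite /box_vol asboolF; last exact/eqP.
  apply: le_ereal_inf_tmp => v [[a [b [-> ->]]]|->]; last exact: leey.
  rewrite -(box_volume_split a b i c) EFinD; apply: leeD.
    apply: le_trans (lebo_hobox_le _ _); apply: le_outer_measure.
    move=> x [abx /= xc] j; rewrite !mxE; have := abx j.
    by case: eqVneq => // ->; rewrite lt_min xc andbT.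
  apply: le_trans (lebo_hobox_le _ _); apply: le_outer_measure.
  move=> x [abx /= /negP]; rewrite -leNgt => xc j; rewrite !mxE; have := abx j.
  by case: eqVneq => // ->; rewrite ge_max xc andbT.
apply: le_ereal_inf_tmp => _ [F [mF XF] <-].
have sub G : lebo R n (X `&` G) <= \sum_(k <oo) lebo R n (F k `&` G).
  apply: le_trans (outer_measure_sigma_subadditive _ _).
  apply: le_outer_measure => x [/XF[k _ Fx] Gx]; by exists k.
apply: (le_trans (leeD (sub H) (sub (~` H)))).
rewrite -nneseriesD; try by move=> *; exact: outer_measure_ge0.
by apply: lee_nneseries => k *; [apply: adde_ge0; exact: outer_measure_ge0|exact: key].
Qed.

Lemma hobox_measurable a b : measurable (hobox a b : set E).
Proof.
have -> : hobox a b = \bigcap_(i in [set: 'I_n])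
   ([set x : E | (x ord0 i < b ord0 i)%R] `&` ~` [set x : E | (x ord0 i < a ord0 i)%R]).
  apply/seteqP; split => [x abx i _|x abx i].
    by case/andP: (abx i) => ax xb; split => //=; apply/negP; rewrite -leNgt.
  by have [/= -> /negP] := abx i I; rewrite -leNgt => ->.
apply: fin_bigcap_measurable => // i _.
by apply: measurableI; [|apply: measurableC]; exact: halfspace_measurable.
Qed.

(** An open set is the union of the countably many boxes with rational corners that it contains. *)
Lemma open_Leb_measurable (U : set 'rV[R]_n) : open U -> measurable (U : set E).
Proof.
move=> oU.
pose q (r : 'rV[rat]_n) : 'rV[R]_n := map_mx ratr r.
have -> : U = \bigcup_(ab : 'rV[rat]_n * 'rV[rat]_n)
    if `[< hobox (q ab.1) (q ab.2) `<=` U >] then hobox (q ab.1) (q ab.2) else set0.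
  apply/seteqP; split => [x Ux|x [ab _]]; last by case: ifPn => // /asboolP; exact.
  have /nbhs_ballP[e /= e0 xeU] : nbhs x U by exact: open_nbhs_nbhs.
  have ex i : exists r : rat * rat,
      [/\ (x ord0 i - e < ratr r.1)%R, (ratr r.1 < x ord0 i)%R,
          (x ord0 i < ratr r.2)%R & (ratr r.2 < x ord0 i + e)%R].
    have /rat_in_itvoo[r1] : (x ord0 i - e < x ord0 i)%R by rewrite ltrBlDr ltrDl.
    have /rat_in_itvoo[r2] : (x ord0 i < x ord0 i + e)%R by rewrite ltrDl.
    by rewrite !in_itv/= => /andP[? ?] /andP[? ?]; exists (r1, r2).
  have [f fP] := choice ex.
  exists (\row_i (f i).1, \row_i (f i).2) => //.
  rewrite asboolT; last first.
    move=> y xy; apply: xeU; split=> // k i; rewrite ord1.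
    have := xy i; rewrite /= !mxE; have [? ? ? ?] := fP i.
    by rewrite /ball/= ltr_norml; lra.
  by move=> i; rewrite !mxE; have [_ /ltW -> -> _] := fP i.
apply: countable_bigcupT_measurable => [|ab].
  exact: countableP.
by case: ifPn => // _; exact: hobox_measurable.
Qed.

Lemma closed_Leb_measurable (F : set 'rV[R]_n) : closed F -> measurable (F : set E).
Proof.
by move=> cF; rewrite -[F]setCK; apply/measurableC/open_Leb_measurable/closed_openC.
Qed.

End BoxMeasure.

(** * Outer regularity by open sets and inner regularity by compact sets *)

Section InnerRegularity.
Context (R : realType) (n : nat).
Local Notation E := (Leb R n).
Local Open Scope ereal_scope.

Definition cube (r : R) : set 'rV[R]_n := [set x | forall i, (`|x ord0 i| <= r)%R].

Lemma compact_cube r : compact (cube r).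
Proof.
have -> : cube r = [set v | forall i, `[(- r)%R, r]%classic (v ord0 i)].
  by apply/seteqP; split => x xr i; have := xr i; rewrite /= in_itv/= ler_norml.
by apply: (rV_compact (A := fun=> `[(- r)%R, r]%classic)) => i; exact: segment_compact.
Qed.

Arguments compact_cube : clear implicits.

Lemma compact_rV_closed (K : set 'rV[R]_n) : compact K -> closed K.
Proof. by apply: compact_closed; exact: norm_hausdorff. Qed.

Lemma cube_Lclass r : Lclass (cube r : set E).
Proof.
split; first by apply: closed_Leb_measurable; apply: compact_rV_closed; exact: compact_cube.
(* The right corner is moved to [r + 1] because [hobox] omits its right faces. *)
pose a : 'rV[R]_n := const_mx (- r)%R; pose b : 'rV[R]_n := const_mx (r + 1)%R.
apply: (@le_lt_trans _ _ (lebo R n (hobox a b))); last first.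
  exact: le_lt_trans (lebo_hobox_le _ _) (ltry _).
apply: le_outer_measure => x xr i; rewrite !mxE; have := xr i.
by rewrite ler_norml => /andP[-> /=]; lra.
Qed.

Lemma compact_sub_cube (K : set 'rV[R]_n) : compact K -> exists r, K `<=` cube r.
Proof.
move=> /compact_bounded[M [_ KM]]; exists (M + 1)%R => x Kx i.
have MM : (M < M + 1)%R by rewrite ltrDl.
apply: le_trans (KM _ MM x Kx); rewrite [leRHS]/Num.norm/= mx_normrE.
by apply/bigmax_geP; right; exists (ord0, i).
Qed.

Lemma compact_Lclass (K : set 'rV[R]_n) : compact K -> Lclass (K : set E).
Proof.
move=> cK; have mK : measurable (K : set E).
  by apply: closed_Leb_measurable; exact: compact_rV_closed.
split=> //; have [r Kr] := compact_sub_cube cK; have [mr] := cube_Lclass r.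
exact: le_lt_trans (le_outer_measure (lebo R n) _ _ Kr).
Qed.

(** Moving the left faces of a box outwards by [1/(k+1)] and leaving them out gives open boxes that
    decrease to it. Continuity from above then selects one of small enough measure. *)
Lemma box_vol_open_superset (B : set 'rV[R]_n) (e : R) : (0 < e)%R ->
  exists U : set 'rV[R]_n,
    [/\ open U, B `<=` U & lebo R n U <= box_vol (B : set (RnB R n)) + e%:E].
Proof.
move=> e0; have [B0|B0] := eqVneq B set0.
  exists set0; split; [exact: open0|by rewrite B0|].
  by rewrite outer_measure0 adde_ge0// ?box_vol_ge0// lee_fin ltW.
have [->|Boo] := eqVneq (box_vol (B : set (RnB R n))) +oo.
  by exists setT; split => //; [exact: openT|rewrite addye// leey].
have Bfin : box_vol (B : set (RnB R n)) \is a fin_num.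
  by rewrite ge0_fin_numE ?box_vol_ge0// ltey.
have e20 : (0 < e / 2)%R by rewrite divr_gt0.
(* [box_vol] is an infimum over all pairs of corners describing [B], so one pair comes within
   [e / 2] of it. *)
have [a [b [Bab Bv]]] : exists a b, B = hobox a b /\
    (box_volume a b)%:E < box_vol (B : set (RnB R n)) + (e / 2)%:E.
  move: Bfin; rewrite /box_vol asboolF; last exact/eqP.
  move=> /(lb_ereal_inf_adherent e20)[v [[a [b [-> ->]]]|->]].
    by move=> ?; exists a, b.
  by rewrite ltNge leey.
pose U (k : nat) := [set x : 'rV[R]_n |
  forall i, (a ord0 i - k.+1%:R^-1 < x ord0 i < b ord0 i)%R].
have oU k : open (U k).
  rewrite openE => x Ux.
  apply: (@filter_forall _ _
    (fun i y => (a ord0 i - k.+1%:R^-1 < y ord0 i < b ord0 i)%R) (nbhs x)) => i.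
  have oi : open [set y : 'rV[R]_n | y ord0 i \in
      `](a ord0 i - k.+1%:R^-1)%R, b ord0 i[%R].
    apply: (@open_comp _ _ (fun y : 'rV[R]_n => y ord0 i)
        `](a ord0 i - k.+1%:R^-1)%R, b ord0 i[%classic).
      by move=> y _; exact: coord_continuous.
    exact: itv_open.
  have : nbhs x [set y : 'rV[R]_n | y ord0 i \in
      `](a ord0 i - k.+1%:R^-1)%R, b ord0 i[%R].
    by apply: open_nbhs_nbhs; split => //=; rewrite in_itv/=; exact: Ux.
  by apply: filterS => y /=; rewrite in_itv.
have mU k : measurable (U k : set E) by exact: open_Leb_measurable.
have UB : \bigcap_k U k = hobox a b.
  apply/seteqP; split => [x Ux i|x abx k _ i]; last first.
    by have /andP[ax ->] := abx i; rewrite andbT (lt_le_trans _ ax)// ltrBlDr ltrDl.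
  have /andP[_ ->] := Ux 0%N I i; rewrite andbT leNgt; apply/negP => xa.
  have xa0 : (0 < a ord0 i - x ord0 i)%R by rewrite subr_gt0.
  have [N _ /(_ N (leqnn N))] := near_infty_natSinv_lt (PosNum xa0).
  rewrite /= ltrBrDl -ltrBrDr => Nax; have /andP[/(lt_trans Nax)] := Ux N I i.
  by rewrite ltxx.
have U0 : lam (U 0%N : set E) < +oo.
  pose a' : 'rV[R]_n := (\row_j (a ord0 j - 1))%R.
  apply: (@le_lt_trans _ _ (lebo R n (hobox a' b))); last first.
    exact: le_lt_trans (lebo_hobox_le _ _) (ltry _).
  apply: le_outer_measure => x U0x i; rewrite mxE.
  by have /andP[/ltW + ->] := U0x i; rewrite invr1 => ->.
have niU : nonincreasing_seq (U : (set E)^nat).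
  move=> k l kl; apply/subsetPset => x Ux i.
  have /andP[ax ->] := Ux i; rewrite andbT (le_lt_trans _ ax)//.
  by rewrite lerD2l lerN2 lef_pV2 ?posrE// ler_nat.
have Ucvg : lam (U k : set E) @[k --> \oo] --> lam (hobox a b : set E).
  rewrite -UB; apply: nonincreasing_cvg_mu => //.
  by rewrite UB; exact: hobox_measurable.
have /open_ereal_lt' lt_ab : lam (hobox a b : set E) < box_vol (B : set (RnB R n)) + (e / 2)%:E.
  exact: le_lt_trans (lebo_hobox_le a b) Bv.
have [N _ /(_ N (leqnn N))/= UN] := Ucvg _ lt_ab.
exists (U N); split => //.
  by rewrite Bab -UB; exact: bigcap_inf.
apply: ltW; apply: (lt_le_trans UN); rewrite leeD2l// lee_fin.
by lra.
Qed.

(** Half of [e] is spent on choosing a nearly optimal cover; the other half is distributed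
    geometrically over open supersets of its members. *)
Lemma lebo_open_superset (X : set 'rV[R]_n) (e : R) :
  lebo R n X < +oo -> (0 < e)%R ->
  exists U : set 'rV[R]_n,
    [/\ open U, X `<=` U & lebo R n U <= lebo R n X + e%:E].
Proof.
move=> Xoo e0; have e20 : (0 < e / 2)%R by rewrite divr_gt0.
have Xfin : lebo R n X \is a fin_num.
  by rewrite ge0_fin_numE ?outer_measure_ge0.
have [_ [F [mF XF] <-] Fv] := lb_ereal_inf_adherent e20 Xfin.
have ex k : exists U : set 'rV[R]_n, [/\ open U, F k `<=` U &
    lebo R n U <= box_vol (F k) + (e / 2 / (2 ^ k.+1)%:R)%:E].
  by apply: box_vol_open_superset; rewrite divr_gt0// ltr0n expn_gt0.
have [U UP] := choice ex.
exists (\bigcup_k U k); split.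
- by apply: bigcup_open => k _; have [] := UP k.
- by move=> x /XF[k _ Fx]; exists k => //; have [_ + _] := UP k; exact.
apply: (le_trans (outer_measure_sigma_subadditive _ _)).
apply: (@le_trans _ _ (\sum_(k <oo) (box_vol (F k) + (e / 2 / (2 ^ k.+1)%:R)%:E))).
  by apply: lee_nneseries => k *; [exact: outer_measure_ge0|have [] := UP k].
apply: (le_trans (epsilon_trick _ _ _)).
- by move=> k; exact: box_vol_ge0.
- exact: ltW.
rewrite [e in leRHS](splitr e) EFinD addeA leeD2r//; exact: ltW.
Qed.

(** Complementation turns outer into inner regularity: a large cube loses little of [A], and
    removing from it a tight open superset of its part outside [A] leaves a compact subset of
    [A]. *)
Lemma compact_subset_approx (A : set E) (e : R) : Lclass A -> (0 < e)%R ->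
  exists K : set 'rV[R]_n,
    [/\ compact K, K `<=` A & lam (A `\` (K : set E)) < e%:E].
Proof.
move=> [mA Aoo] e0; have e20 : (0 < e / 2)%R by rewrite divr_gt0.
pose C k : set E := cube k%:R.
have mC k : measurable (C k) by have [] := cube_Lclass k%:R.
have [N AN] : exists N, lam (A `\` C N) < (e / 2)%:E.
  pose D k := A `\` C k.
  have D0 : \bigcap_k D k = set0.
    rewrite -subset0 => x Dx.
    have [r xr] := compact_sub_cube (@compact_set1 'rV[R]_n x).
    have [_ ] := Dx (Num.truncn r).+1 I; apply => i; apply: (le_trans (xr x erefl i)).
    by rewrite ltW// truncnS_gt.
  have mD k : measurable (D k) by exact: measurableD.
  have : lam (D k) @[k --> \oo] --> lam (\bigcap_k D k).
    apply: nonincreasing_cvg_mu => //.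
    - by apply: le_lt_trans Aoo; apply: le_measure; rewrite ?inE//; exact: subDsetl.
    - by rewrite D0; exact: measurable0.
    - move=> k l kl; apply/subsetPset; apply: setDS => x xk i.
      by apply: (le_trans (xk i)); rewrite ler_nat.
  have /open_ereal_lt' lt0 : 0 < (e / 2)%:E by rewrite lte_fin.
  rewrite D0 measure0 => /(_ _ lt0)[N _ /(_ N (leqnn N))/= DN].
  by exists N.
have CNoo : lam (C N) < +oo by have [] := cube_Lclass N%:R.
pose X : set E := C N `\` A.
have mX : measurable X by exact: measurableD.
have Xoo : lam X < +oo.
  by apply: le_lt_trans CNoo; apply: le_measure; rewrite ?inE//; exact: subDsetl.
have [U [oU XU UX]] := lebo_open_superset Xoo e20.
have mU : measurable (U : set E) by exact: open_Leb_measurable.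
exists (C N `\` U); split.
- apply: (subclosed_compact _ (compact_cube N%:R)); last exact: subDsetl.
  apply: closedI; [by apply: compact_rV_closed; exact: compact_cube|exact: open_closedC].
- move=> x [Cx Ux]; apply: contrapT => Ax; apply: Ux; exact: XU.
(* A point of [A] that is missed lies outside the cube, or lies in [U] but not in [X]. Each part
   costs at most [e / 2]. *)
apply: (@le_lt_trans _ _ (lam ((A `\` C N) `|` ((U : set E) `\` X)))).
  apply: le_measure; rewrite ?inE.
  - apply: measurableD => //; exact: measurableD.
  - by apply: measurableU; exact: measurableD.
  - move=> x [Ax nK]; have [Cx|Cx] := pselect (C N x); last by left.
    right; split; last by case.
    by apply: contrapT => Ux; apply: nK.
apply: (le_lt_trans (measureU2 _ _ _)); try exact: measurableD.
have Xfin : lam X \is a fin_num by rewrite ge0_fin_numE.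
have UXe : lam ((U : set E) `\` X) <= (e / 2)%:E.
  have Uoo : lam (U : set E) < +oo.
    by apply: le_lt_trans UX _; rewrite lte_add_pinfty// ltry.
  by rewrite measureD// setIidr// leeBlDl.
rewrite [e in ltRHS](splitr e) EFinD lte_leD//.
by rewrite ge0_fin_numE// (le_lt_trans UXe)// ltry.
Qed.
End InnerRegularity.

(** * Almost everywhere inclusion and equality of sets *)

Section MeasureFacts.
Context d (T : measurableType d) (R : realType) (mu : {measure set T -> \bar R}).
Implicit Types A B : set T.
Local Open Scope ereal_scope.

Lemma measurable_ge_set (f : T -> R) c : measurable_fun setT f ->
  measurable [set x | (c <= f x)%R].
Proof.
move=> mf; have -> : [set x | (c <= f x)%R] = setT `&` f @^-1` `[c, +oo[%classic.
  by apply/seteqP; split => x; rewrite /= in_itv/= andbT => // -[].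
by apply: mf => //; exact: measurable_itv.
Qed.

Lemma measurable_gt_set (f : T -> R) c : measurable_fun setT f ->
  measurable [set x | (c < f x)%R].
Proof.
move=> mf; have -> : [set x | (c < f x)%R] = setT `&` f @^-1` `]c, +oo[%classic.
  by apply/seteqP; split => x; rewrite /= in_itv/= andbT => // -[].
by apply: mf => //; exact: measurable_itv.
Qed.

Lemma ae_subset_null A B : measurable A -> measurable B ->
  {ae mu, forall x, A x -> B x} <-> mu (A `\` B) = 0.
Proof.
move=> mA mB; rewrite -(negligibleP mu (measurableD mA mB)).
have -> // : A `\` B = ~` [set x | A x -> B x].
by apply/seteqP; split => x /=; rewrite not_implyE.
Qed.

(** Both sets have the finite measure of their intersection, so the other difference is null too.
    This upgrades the one-sided inclusions that monotonicity provides to equalities. *)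
Lemma ae_subset_sym A B : measurable A -> measurable B -> mu A < +oo ->
  mu A = mu B -> {ae mu, forall x, A x -> B x} -> {ae mu, forall x, B x -> A x}.
Proof.
move=> mA mB Aoo AB /(ae_subset_null mA mB) AB0; apply/(ae_subset_null mB mA).
have mI : measurable (A `&` B) by exact: measurableI.
have AI : mu A = mu (A `&` B) by rewrite (measureDI mu mA mB)/= AB0 add0e.
have Ifin : mu (A `&` B) \is a fin_num by rewrite ge0_fin_numE// -AI.
have := measureDI mu mB mA; rewrite /= -AB AI [B `&` A]setIC => BA.
by rewrite -[LHS](addeK _ Ifin) -BA subee.
Qed.

Lemma ae_eq_measure A B : measurable A -> measurable B ->
  {ae mu, forall x, A x <-> B x} -> mu A = mu B.
Proof.
move=> mA mB AB.
have AB0 : mu (A `\` B) = 0.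
  by apply/ae_subset_null => //; apply: filterS AB => x [].
have BA0 : mu (B `\` A) = 0.
  by apply/ae_subset_null => //; apply: filterS AB => x [].
by rewrite (measureDI mu mA mB) (measureDI mu mB mA)/= AB0 BA0 setIC.
Qed.

End MeasureFacts.

(** * Closed superlevel sets of functions in [inV] *)

Section LevelSets.
Context (R : realType) (n : nat).
Local Notation E := (Leb R n).
Implicit Types (f g u v : E -> R) (A B : set E).
Local Open Scope ereal_scope.

Lemma ge_level_Lclass f t : inV f -> (0 < t)%R -> Lclass [set x | (t <= f x)%R].
Proof.
move=> [f0 mf fV] t0; split; first exact: measurable_ge_set.
have t20 : (0 < t / 2)%R by rewrite divr_gt0.
apply: le_lt_trans (fV _ t20); apply: le_measure; rewrite ?inE.
- exact: measurable_ge_set.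
- exact: measurable_gt_set.
- by move=> x /=; lra.
Qed.

(** A closed level set is the decreasing intersection of strict ones at heights increasing to [c],
    and continuity from above passes to the limit. *)
Lemma equimeasurable_ge_set u v : inV u -> inV v ->
  (forall t, lam [set x | (t < u x)%R] = lam [set x | (t < v x)%R]) ->
  forall c, (0 < c)%R -> lam [set x | (c <= u x)%R] = lam [set x | (c <= v x)%R].
Proof.
(* With [k.+2] every [s k] is positive, starting at [c / 2]; [inV] gives finite measure only at
   positive heights. *)
move=> uV vV uv c c0; pose s (k : nat) : R := (c - c * k.+2%:R^-1)%R.
have s_gt0 k : (0 < s k)%R.
  by rewrite subr_gt0 gtr_pMr// invf_lt1// ltr1n.
have cvg_level (w : E -> R) : inV w ->
    lam [set x | (s k < w x)%R] @[k --> \oo] --> lam [set x | (c <= w x)%R].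
  move=> [w0 mw wV].
  have -> : [set x | (c <= w x)%R] = \bigcap_k [set x | (s k < w x)%R].
    apply/seteqP; split => [x /= cw k _ /=|x /= h].
      by apply: lt_le_trans cw; rewrite ltrBlDr ltrDl mulr_gt0// invr_gt0.
    rewrite leNgt; apply/negP => wc.
    have e0 : (0 < (c - w x) / c)%R by rewrite divr_gt0// subr_gt0.
    have [N _ /(_ N.+1 (leqnSn N))/=] := near_infty_natSinv_lt (PosNum e0).
    rewrite ltr_pdivlMr// mulrC ltrBrDl -ltrBrDr => Nc.
    by have /(lt_trans Nc) := h N I; rewrite ltxx.
  apply: (@nonincreasing_cvg_mu _ E R lam (fun k => [set x | (s k < w x)%R])).
  - exact: wV.
  - by move=> k; exact: measurable_gt_set.
  - by apply: bigcapT_measurable => k; exact: measurable_gt_set.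
  - move=> k l kl; apply/subsetPset => x /=; apply: le_lt_trans.
    by rewrite lerD2l lerN2 ler_pM2l// lef_pV2 ?posrE// ler_nat.
have uvE : (fun k => lam [set x | (s k < u x)%R]) = (fun k => lam [set x | (s k < v x)%R]).
  by apply/funext => k; exact: uv.
have := cvg_level u uV; rewrite uvE => cu.
by apply: (cvg_unique _ cu (cvg_level v vV)).
Qed.

End LevelSets.

(** * Action of rearrangements on indicators, level sets and compositions *)

Section Rearrangements.
Context (R : realType) (n : nat).
Local Notation E := (Leb R n).
Implicit Types (c : R) (f g u v : E -> R) (A B : set E) (S T : (E -> R) -> (E -> R)).
Local Open Scope ereal_scope.

Lemma scale_indic_inV c A : (0 <= c)%R -> Lclass A ->
  inV (fun x => c * \1_A x)%R.
Proof.
move=> c0 [mA Aoo].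
have mf : measurable_fun setT (fun x => c * \1_A x)%R.
  by apply: measurable_funM => //; exact: measurable_indic.
split=> // [x|t t0]; first by rewrite mulr_ge0.
apply: le_lt_trans Aoo; apply: le_measure; rewrite ?inE//.
  exact: measurable_gt_set.
move=> x /=; rewrite indicE; have [/set_mem//|_] := boolP (x \in A).
by rewrite mulr0 ltNge (ltW t0).
Qed.

Lemma indic_inV A : Lclass A -> inV (\1_A : E -> R).
Proof.
move=> lA; have := scale_indic_inV ler01 lA.
by congr inV; apply/funext => x; rewrite mul1r.
Qed.

Lemma scale_indic_ge_level c A : (0 < c)%R ->
  [set x | (c <= c * \1_A x)%R] = A.
Proof.
move=> c0; apply/seteqP; split => x /=; rewrite indicE.
  have [/set_mem//|_] := boolP (x \in A).
  by rewrite mulr0 leNgt c0.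
by move=> /mem_set ->; rewrite mulr1.
Qed.

Lemma scale_indic_gt0_level c A : (0 < c)%R ->
  [set x | (0 < c * \1_A x)%R] = A.
Proof.
move=> c0; apply/seteqP; split => x /=; rewrite indicE.
  have [/set_mem//|_] := boolP (x \in A).
  by rewrite mulr0 ltxx.
by move=> /mem_set ->; rewrite mulr1.
Qed.

Lemma scale_indic_gt_level c A : (0 < c)%R ->
  [set x | (c < c * \1_A x)%R] = set0.
Proof.
move=> c0; rewrite -subset0 => x /=; rewrite indicE.
by case: (x \in A); rewrite ?mulr1 ?mulr0 ?ltxx// ltNge (ltW c0).
Qed.

Section OneRearrangement.
Variable T : (E -> R) -> (E -> R).
Hypothesis rT : rearrangement T.

Lemma rearrangement_ge_level f c : inV f -> (0 < c)%R ->
  lam [set x | (c <= T f x)%R] = lam [set x | (c <= f x)%R].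
Proof.
move=> fV c0; have [TV eT _] := rT.
exact: (equimeasurable_ge_set (TV _ fV) fV (eT _ fV)).
Qed.

Lemma rearrangement_ae_eq f g : inV f -> inV g ->
  {ae lam, forall x, f x = g x} -> {ae lam, forall x, T f x = T g x}.
Proof.
move=> fV gV fg; have [_ _ mT] := rT.
have h1 : {ae lam, forall x, (T f x <= T g x)%R}.
  by apply: mT => //; apply: filterS fg => x ->.
have h2 : {ae lam, forall x, (T g x <= T f x)%R}.
  by apply: mT => //; apply: filterS fg => x ->.
by apply: filterS2 h1 h2 => x ? ?; apply/eqP; rewrite eq_le; apply/andP.
Qed.

(** The levels [0 < h] and [c <= h] both have the measure of [A] and the level [c < h] is null, so
    the image [h] takes only the values 0 and [c] a.e. *)
Lemma rearrangement_scale_indic c A : (0 < c)%R -> Lclass A ->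
  [/\ lam [set x | (c <= T (fun y => c * \1_A y) x)%R] = lam A,
     {ae lam, forall x, (0 < T (fun y => c * \1_A y) x)%R ->
        (c <= T (fun y => c * \1_A y) x)%R} &
     {ae lam, forall x, (T (fun y => c * \1_A y) x <= c)%R}].
Proof.
move=> c0 lA; have [TV eT _] := rT.
have hV := scale_indic_inV (ltW c0) lA.
set h := T _; have [h0 mh hoo] : inV h by exact: TV.
have hc : lam [set x | (c <= h x)%R] = lam A.
  by rewrite (rearrangement_ge_level hV c0) scale_indic_ge_level.
have h0A : lam [set x | (0 < h x)%R] = lam A by rewrite (eT _ hV) scale_indic_gt0_level.
split; first exact: hc.
  apply: (@ae_subset_sym _ _ _ lam [set x | (c <= h x)%R] [set x | (0 < h x)%R]).
  - exact: measurable_ge_set.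
  - exact: measurable_gt_set.
  - by rewrite hc; case: lA.
  - by rewrite hc h0A.
  - by apply: aeW => x /=; exact: lt_le_trans.
exists [set x | (c < h x)%R]; split.
- exact: measurable_gt_set.
- by rewrite (eT _ hV) scale_indic_gt_level// measure0.
- by move=> x /= /negP; rewrite -ltNge.
Qed.

(** This is the two-valued property at [c = 1]: a.e. the image is 0 or 1, and [diamond] records
    where it is 1. *)
Lemma rearrangement_indic A : Lclass A ->
  {ae lam, forall x, T \1_A x = \1_(diamond T A) x}.
Proof.
move=> lA; have [TV _ _] := rT.
have [T0 _ _] := TV _ (indic_inV lA).
have [_ + +] := rearrangement_scale_indic ltr01 lA.
under [fun y => (1 * _)%R]eq_fun do rewrite mul1r.
apply: filterS2 => x h1 h2; rewrite indicE.
have [xd|xd] := boolP (x \in diamond T A).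
  by have := set_mem xd.
have [T1|] := ltP 0%R (T \1_A x); last first.
  by move=> h; apply/eqP; rewrite eq_le h T0.
exfalso; move/negP: xd; apply; apply/mem_set => /=.
by apply/eqP; rewrite eq_le h2 h1.
Qed.

Lemma diamond_Lclass A : Lclass A ->
  Lclass (diamond T A) /\ lam (diamond T A) = lam A.
Proof.
move=> lA; have [TV _ _] := rT.
have [T0 mT _] := TV _ (indic_inV lA).
have mD : measurable (diamond T A).
  have -> : diamond T A = [set x | (1 <= T \1_A x)%R] `\` [set x | (1 < T \1_A x)%R].
    apply/seteqP; split => x /=; first by move=> ->; rewrite ltxx.
    by move=> [h /negP]; rewrite -leNgt => h'; apply/eqP; rewrite eq_le h h'.
  by apply: measurableD; [exact: measurable_ge_set|exact: measurable_gt_set].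
suff e : lam (diamond T A) = lam A by split=> //; split=> //; rewrite e; case: lA.
have <- : lam [set x | (1 <= T \1_A x)%R] = lam A.
  rewrite (rearrangement_ge_level (indic_inV lA) ltr01).
  congr (lam _); rewrite -[RHS](scale_indic_ge_level A ltr01).
  by apply/seteqP; split => x /=; rewrite mul1r.
apply: ae_eq_measure => //; first exact: measurable_ge_set.
apply: filterS (rearrangement_indic lA) => x /= Tx; rewrite /diamond/= Tx indicE.
by case: (_ \in _) => /=; split=> //; rewrite ?ler10 // => /eqP; rewrite eq_sym oner_eq0.
Qed.

(* Comparing [T (c 1_A)] with [T 1_A] only uses monotonicity: whichever of the
   two is smaller, their supports are nested and have the same measure. *)
Lemma diamond_sub_scale_indic c A : (0 < c)%R -> Lclass A ->
  {ae lam, forall x, diamond T A x -> (c <= T (fun y => c * \1_A y) x)%R}.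
Proof.
move=> c0 lA; have [TV _ mT] := rT.
have hV := scale_indic_inV (ltW c0) lA.
have [hc h0c _] := rearrangement_scale_indic c0 lA.
have [_ mh _] := TV _ hV.
have [[mD Doo] DA] := diamond_Lclass lA.
have TI := rearrangement_indic lA.
have [c1|c1] := leP c 1%R.
  apply: (@ae_subset_sym _ _ _ lam [set x | (c <= T (fun y => c * \1_A y) x)%R]).
  - exact: measurable_ge_set.
  - exact: mD.
  - by rewrite hc -DA.
  - by rewrite hc -DA.
  have hT : {ae lam, forall x, (T (fun y => c * \1_A y) x <= T \1_A x)%R}.
    apply: (mT _ _ hV (indic_inV lA)).
    by apply: aeW => x; rewrite ler_piMl.
  apply: filterS2 hT TI => x hTx TIx /= ch; apply: contrapT => xD.
  have := lt_le_trans c0 (le_trans ch hTx).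
  by rewrite TIx indicE memNset// ltxx.
have hT : {ae lam, forall x, (T \1_A x <= T (fun y => c * \1_A y) x)%R}.
  apply: (mT _ _ (indic_inV lA) hV).
  by apply: aeW => x; rewrite ler_peMl// ltW.
apply: filterS2 hT h0c => x hTx h0 Dx; apply: h0; apply: lt_le_trans hTx.
by rewrite (_ : T \1_A x = 1%R).
Qed.

Lemma diamond_ge_level f c : inV f -> (0 < c)%R ->
  {ae lam, forall x, (c <= T f x)%R <-> diamond T [set y | (c <= f y)%R] x}.
Proof.
move=> fV c0; have [TV eT mT] := rT.
set A := [set y | _]; have lA : Lclass A := ge_level_Lclass fV c0.
have [[mD Doo] DA] := diamond_Lclass lA.
have [_ mTf _] := TV _ fV.
have hT : {ae lam, forall x, (T (fun y => c * \1_A y) x <= T f x)%R}.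
  apply: (mT _ _ (scale_indic_inV (ltW c0) lA) fV).
  apply: aeW => x; rewrite indicE; case: (boolP (x \in A)) => [/set_mem|_].
    by rewrite mulr1.
  by rewrite mulr0; have [f0 _ _] := fV.
have sub : {ae lam, forall x, diamond T A x -> (c <= T f x)%R}.
  by apply: filterS2 hT (diamond_sub_scale_indic c0 lA) => x h1 h2 /h2 /le_trans; exact.
have sup : {ae lam, forall x, [set x | (c <= T f x)%R] x -> diamond T A x}.
  apply: (@ae_subset_sym _ _ _ lam (diamond T A)).
  - exact: mD.
  - exact: measurable_ge_set.
  - exact: Doo.
  - by rewrite DA (rearrangement_ge_level fV c0).
  - exact: sub.
by apply: filterS2 sub sup => x h1 h2; split.
Qed.

Lemma diamond_subset A B : Lclass A -> Lclass B -> A `<=` B ->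
  {ae lam, forall x, diamond T A x -> diamond T B x}.
Proof.
move=> lA lB AB; have [_ _ mT] := rT.
have hT : {ae lam, forall x, (T \1_A x <= T \1_B x)%R}.
  apply: (mT _ _ (indic_inV lA) (indic_inV lB)).
  apply: aeW => x; rewrite !indicE ler_nat.
  by case: (boolP (x \in A)) => // /set_mem/AB/mem_set ->.
apply: filterS2 hT (rearrangement_indic lB) => x hTx TBx Ax; apply: contrapT => Bx.
move: hTx; rewrite (_ : T \1_A x = 1%R)// TBx indicE memNset//.
by rewrite ler10.
Qed.

End OneRearrangement.

Lemma rearrangement_comp S T : rearrangement S -> rearrangement T ->
  rearrangement (S \o T).
Proof.
move=> [SV eS mS] [TV eT mT]; split.
- move=> f fV; exact: SV (TV _ fV).
- move=> f fV t; exact: (etrans (eS _ (TV _ fV) t) (eT _ fV t)).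
- move=> f g fV gV fg; exact: (mS _ _ (TV _ fV) (TV _ gV) (mT _ _ fV gV fg)).
Qed.

Lemma rearrangement_id : rearrangement (@id (E -> R)).
Proof. by split. Qed.

(** [B] agrees with [diamond T A] only a.e., which is what an induction over compositions supplies.
    The indicator of [B] and the image of that of [A] are then a.e. equal, and [S] respects a.e.
    equality. *)
Lemma diamond_comp S T A B : rearrangement S -> rearrangement T ->
  Lclass A -> Lclass B -> {ae lam, forall x, B x <-> diamond T A x} ->
  {ae lam, forall x, diamond S B x <-> diamond (S \o T) A x}.
Proof.
move=> rS rT lA lB BA; have [TV _ _] := rT.
have eq1 : {ae lam, forall x, \1_B x = T \1_A x :> R}.
  apply: filterS2 BA (rearrangement_indic rT lA) => x BAx ->.
  rewrite !indicE; suff -> : (x \in B) = (x \in diamond T A) by [].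
  by apply/idP/idP => /set_mem/BAx/mem_set.
apply: filterS (rearrangement_ae_eq rS (indic_inV lB) (TV _ (indic_inV lA)) eq1) => x.
by rewrite /diamond /= => ->.
Qed.

Lemma compn_rearrangement (S : nat -> (E -> R) -> (E -> R)) k :
  (forall k, rearrangement (S k)) -> rearrangement (compn S k).
Proof.
move=> rS; elim: k => [|k IH]; first exact: rearrangement_id.
exact: rearrangement_comp (rS k) IH.
Qed.

(** Membership in [Lclass] is carried through the induction because the a.e. statements about
    [diamond] apply to such sets only. *)
Lemma compn_diamond (S : nat -> (E -> R) -> (E -> R)) k A :
  (forall k, rearrangement (S k)) -> Lclass A ->
  Lclass (compn (fun k => diamond (S k)) k A) /\
  {ae lam, forall x, compn (fun k => diamond (S k)) k A x <->
     diamond (compn S k) A x}.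
Proof.
move=> rS lA; elim: k => [|k [IHl IH]].
  split=> //; apply: filterE => x; rewrite /diamond /= indicE.
  case: (boolP (x \in A)) => [/set_mem|/negP xA]; first by split.
  split => [/mem_set//|/eqP]; by rewrite eq_sym oner_eq0.
split; first by have [] := diamond_Lclass (rS k) IHl.
exact: (diamond_comp (rS k) (compn_rearrangement k rS) lA IHl IH).
Qed.

End Rearrangements.

(** * Power inequalities and step approximation of real numbers *)

Section RealFacts.
Context {R : realType}.
Implicit Types (x y z p e : R) (m : nat).

Lemma powR_le_self x p : 0 <= x <= 1 -> 1 <= p -> x `^ p <= x.
Proof.
move=> /andP[x0 x1] p1; move: x0; rewrite le_eqVlt => /predU1P[<-|x0].
  by rewrite powR0// gt_eqF// (lt_le_trans _ p1).
by apply: ge1r_powR => //; rewrite x0.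
Qed.

(** For [0 <= z <= x] the ratio [z / x] is at most 1, so the power of [z] is at most that of [x]
    times [z / x]. Adding this for [z = x - y] and [z = y] gives the claim. *)
Lemma powR_superadditive x y p : 0 <= y -> y <= x -> 1 <= p ->
  (x - y) `^ p <= x `^ p - y `^ p.
Proof.
move=> y0 yx p1; have p0 : p != 0 by rewrite gt_eqF// (lt_le_trans _ p1).
have := le_trans y0 yx; rewrite le_eqVlt => /predU1P[x0|x0].
  by rewrite (_ : y = 0) -?x0 ?subr0 ?powR0 ?subr0//; lra.
have xE z : z = x * (z / x) by rewrite mulrCA divff ?mulr1// gt_eqF.
rewrite lerBrDr [X in X `^ _ + _]xE [X in _ + X `^ _]xE.
have h z : 0 <= z <= x -> (x * (z / x)) `^ p <= x `^ p * (z / x).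
  move=> /andP[z0 zx]; have zx0 : 0 <= z / x by rewrite divr_ge0// ltW.
  rewrite powRM//; last exact: ltW.
  apply: ler_wpM2l; first exact: powR_ge0.
  by apply: powR_le_self => //; rewrite zx0 ler_pdivrMr// mul1r.
apply: (le_trans (lerD (h (x - y) _) (h y _))); [lra|lra|].
by rewrite -mulrDr -mulrDl subrK divff ?mulr1// gt_eqF.
Qed.

Lemma powR_dist_le x y p : 0 <= x -> 0 <= y -> 1 <= p ->
  `|x - y| `^ p <= `|x `^ p - y `^ p|.
Proof.
move=> x0 y0 p1.
wlog yx : x y x0 y0 / y <= x.
  move=> h; have [yx|/ltW xy] := leP y x; first exact: h.
  by have := h y x y0 x0 xy; rewrite (distrC y) (distrC (y `^ p)).
rewrite ger0_norm ?subr_ge0//; apply: le_trans (ler_norm _).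
exact: powR_superadditive.
Qed.

Lemma powR_ge_level x p c : 0 < p -> 0 <= x -> 0 < c ->
  (c <= x `^ p) = (c `^ p^-1 <= x).
Proof.
move=> p0 x0 c0; have pN0 : p != 0 by rewrite gt_eqF.
apply/idP/idP => h.
  have -> : x = (x `^ p) `^ p^-1 by rewrite -powRrM divff// powRr1.
  by apply: ge0_ler_powR => //; rewrite ?invr_ge0 ?nnegrE ?powR_ge0// ltW.
have -> : c = (c `^ p^-1) `^ p by rewrite -powRrM mulVf// powRr1// ltW.
by apply: ge0_ler_powR => //; rewrite ?nnegrE ?powR_ge0// ltW.
Qed.

(** The heights start at [1/(m+1)] rather than 0, since only positive heights have controlled level
    sets. *)
Definition step_level m (j : nat) : R := j.+1%:R * m.+1%:R^-1.

(** For [y >= 0] this is [y] rounded down to a multiple of [1/(m+1)] and capped at [m+1]. Writing it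
    as a sum over the levels reached makes its integral a combination of measures of level sets. *)
Definition step_approx m y : R :=
  \sum_(j < m.+1 ^ 2) m.+1%:R^-1 * (step_level m j <= y)%R%:R.

Lemma step_level_gt0 m j : 0 < step_level m j.
Proof. by rewrite mulr_gt0// invr_gt0. Qed.

Lemma step_approx_ge0 m y : 0 <= step_approx m y.
Proof. by apply: sumr_ge0 => j _; rewrite mulr_ge0// invr_ge0. Qed.

Lemma step_approx_le m y : 0 <= y -> step_approx m y <= y.
Proof.
move=> y0; rewrite /step_approx; set e := m.+1%:R^-1.
have e0 : 0 < e by rewrite invr_gt0.
(* The bound [N * e] is carried along for the induction: a new term is added only if
   [(N + 1) * e <= y], and then this bound keeps the sum below [y]. *)
suff h N : \sum_(j < N) e * (step_level m j <= y)%R%:R <= Num.min y (N%:R * e).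
  by apply: (le_trans (h _)); rewrite ge_min lexx.
elim: N => [|N IH]; first by rewrite big_ord0 mul0r le_min y0 lexx.
rewrite big_ord_recr/= /step_level -/e -[in X in _ <= Num.min _ X]natr1.
move: IH; rewrite -!natr1 !le_min !mulrDl mul1r => /andP[h1 h2].
by case: (leP (N%:R * e + e) y) => h; rewrite ?mulr1 ?mulr0; apply/andP; split; lra.
Qed.

Lemma step_approx_ge m y : y <= m.+1%:R -> y - m.+1%:R^-1 <= step_approx m y.
Proof.
move=> ym; rewrite /step_approx; set e := m.+1%:R^-1.
have e0 : 0 < e by rewrite invr_gt0.
suff h N : y <= N%:R * e -> y - e <= \sum_(j < N) e * (step_level m j <= y)%R%:R.
  by apply: h; rewrite natrX expr2 mulfK// pnatr_eq0.
elim: N => [|N IH]; first by rewrite big_ord0 mul0r; lra.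
rewrite big_ord_recr/= -natr1 mulrDl mul1r => yN.
have t0 : 0 <= e * (step_level m N <= y)%R%:R by rewrite mulr_ge0// ltW.
(* If [y] exceeds [N * e], all earlier levels are reached and the partial sum is exactly [N * e]. *)
have [/IH|Ny] := leP y (N%:R * e); first lra.
have -> : \sum_(j < N) e * (step_level m j <= y)%R%:R = N%:R * e.
  rewrite (eq_bigr (fun=> e)).
    by rewrite sumr_const card_ord mulr_natl.
  move=> j _; suff -> : step_level m j <= y by rewrite mulr1.
  apply: le_trans (ltW Ny); rewrite ler_pM2r// ler_nat; exact: ltn_ord.
lra.
Qed.

Lemma step_approx_cvg y : 0 <= y -> step_approx m y @[m --> \oo] --> y.
Proof.
move=> y0; apply/cvgrPdist_le => /= e e0.
have [N _ hN] := near_infty_natSinv_lt (PosNum e0).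
(* Past [N] the mesh is finer than [e]; past the truncation of [y] the cap [m + 1] is above [y]. *)
exists (maxn N (Num.truncn y)) => // m /=; rewrite geq_max => /andP[Nm ym].
rewrite ger0_norm ?subr_ge0 ?step_approx_le//.
have := step_approx_ge (y := y) (m := m) _.
have ym' : y <= m.+1%:R by rewrite (le_trans (ltW (truncnS_gt y)))// ler_nat ltnS.
move=> /(_ ym') h; have /= h2 := hN m Nm; apply: le_trans (ltW h2).
by rewrite lerBlDr -lerBlDl.
Qed.

Lemma dist_step_approx_le m y z : 0 <= y -> 0 <= z ->
  `|y - z| <= (y - step_approx m y) + (z - step_approx m z) +
    \sum_(j < m.+1 ^ 2) m.+1%:R^-1 *
      `|(step_level m j <= y)%R%:R - (step_level m j <= z)%R%:R|.
Proof.
move=> y0 z0; have hy := step_approx_le m y0; have hz := step_approx_le m z0.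
have : `|step_approx m y - step_approx m z| <= \sum_(j < m.+1 ^ 2) m.+1%:R^-1 *
      `|(step_level m j <= y)%R%:R - (step_level m j <= z)%R%:R|.
  rewrite -sumrB; apply: (le_trans (ler_norm_sum _ _ _)); apply: ler_sum => j _.
  by rewrite -mulrBr normrM ger0_norm// invr_ge0.
set s := \sum_(_ < _) _; rewrite !ler_norml => /andP[h1 h2].
by apply/andP; split; lra.
Qed.

End RealFacts.

(** * Integrals of step approximations and their remainders *)

Section StepIntegral.
Context d (T : measurableType d) (R : realType) (mu : {measure set T -> \bar R}).
Implicit Types (F G : T -> R) (m : nat).
Local Open Scope ereal_scope.

Let ind F c : (fun x => ((c <= F x)%R%:R : R)) = \1_[set x | (c <= F x)%R].
Proof.
apply/funext => x; rewrite indicE.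
suff -> : (x \in [set x | (c <= F x)%R]) = (c <= F x)%R by [].
by apply/idP/idP => [/set_mem|h]; [|exact/mem_set].
Qed.

Lemma measurable_step_term F c (k : R) : measurable_fun setT F ->
  measurable_fun setT (fun x => k * (c <= F x)%R%:R)%R.
Proof.
move=> mF; apply: measurable_funM => //; rewrite ind.
exact/measurable_indic/measurable_ge_set.
Qed.

Lemma measurable_step_approx F m : measurable_fun setT F ->
  measurable_fun setT (fun x => step_approx m (F x)).
Proof. by move=> mF; apply: measurable_sum => j; exact: measurable_step_term. Qed.

Lemma integral_step_approx F m : measurable_fun setT F ->
  \int[mu]_x (step_approx m (F x))%:E =
  \sum_(j < m.+1 ^ 2) (m.+1%:R^-1)%:E * mu [set x | (step_level m j <= F x)%R].
Proof.
move=> mF; under eq_integral do rewrite /step_approx -sumEFin.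
rewrite ge0_integral_sum//; last first.
  by move=> j; apply/measurable_EFinP; exact: measurable_step_term.
apply: eq_bigr => j _; under eq_integral do rewrite EFinM.
have mj := measurable_ge_set (@step_level R m j) mF.
rewrite ge0_integralZl_EFin//; last first.
  by apply/measurable_EFinP; rewrite ind; exact: measurable_indic.
rewrite [X in \int[_]_x (X x)%:E](ind F (@step_level R m j)).
by rewrite integral_indic// setIT.
Qed.


(** The sum form avoids a difference of integrals that may be infinite. *)
Lemma integral_step_remainder F m : measurable_fun setT F ->
  (forall x, 0 <= F x)%R ->
  \int[mu]_x (F x - step_approx m (F x))%:E + \int[mu]_x (step_approx m (F x))%:E =
  \int[mu]_x (F x)%:E.
Proof.
move=> mF F0; have ms := measurable_step_approx m mF.
have r0 x : setT x -> 0 <= (F x - step_approx m (F x))%:E.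
  by move=> _; rewrite lee_fin subr_ge0 step_approx_le.
have mr : measurable_fun setT (fun x => (F x - step_approx m (F x))%:E).
  by apply/measurable_EFinP; exact: measurable_funB.
have s0 x : setT x -> 0 <= (step_approx m (F x))%:E.
  by move=> _; rewrite lee_fin step_approx_ge0.
rewrite -(ge0_integralD mu measurableT r0 mr s0 ((measurable_EFinP _ _).2 ms)).
by apply: eq_integral => x _; rewrite -EFinD subrK.
Qed.

Section Dominated.
Variable F : T -> R.
Hypotheses (mF : measurable_fun setT F) (F0 : forall x, (0 <= F x)%R)
  (Foo : \int[mu]_x (F x)%:E < +oo).

Lemma integral_step_approx_lt m : \int[mu]_x (step_approx m (F x))%:E < +oo.
Proof.
apply: le_lt_trans Foo; apply: ge0_le_integral => //.
- by move=> x _; rewrite lee_fin step_approx_ge0.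
- by apply/measurable_EFinP; exact: measurable_step_approx.
- exact/measurable_EFinP.
- by move=> x _; rewrite lee_fin step_approx_le.
Qed.

(** [F] dominates its own step approximations, which converge to it pointwise; dominated convergence
    yields both limits. *)
Lemma step_approx_dominated :
  \int[mu]_x (F x - step_approx m (F x))%:E @[m --> \oo] --> 0 /\
  \int[mu]_x (step_approx m (F x))%:E @[m --> \oo] --> \int[mu]_x (F x)%:E.
Proof.
have iF : mu.-integrable setT (EFin \o F).
  apply/integrableP; split; first exact/measurable_EFinP.
  by under eq_integral do rewrite /= ger0_norm//.
have cF : {ae mu, forall x, setT x -> (step_approx m (F x))%:E @[m --> \oo] --> (F x)%:E}.
  apply: aeW => x _; apply: cvg_EFin; first exact: nearW.
  exact: step_approx_cvg.
have dF : {ae mu, forall x m, setT x -> `|(step_approx m (F x))%:E| <= (F x)%:E}.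
  apply: aeW => x m _; rewrite lee_fin ger0_norm ?step_approx_ge0//.
  exact: step_approx_le.
have [_ h1 h2] := dominated_convergence measurableT
  (fun m => (measurable_EFinP _ _).2 (measurable_step_approx m mF))
  ((measurable_EFinP _ _).2 mF) cF iF dF.
split; last exact: h2.
rewrite (_ : (fun m => _) = [sequence \int[mu]_x `|(step_approx m (F x))%:E - (F x)%:E|]_m)//.
apply/funext => m; apply: eq_integral => x _.
by rewrite -EFinB abse_EFin distrC ger0_norm// subr_ge0 step_approx_le.
Qed.

(* The integrals of the step approximations only see the measures of the level
   sets, so Fatou's lemma transfers them from [F] to [G]. *)
Lemma equidistributed_integral_le G : measurable_fun setT G ->
  (forall x, 0 <= G x)%R ->
  (forall c, (0 < c)%R -> mu [set x | (c <= G x)%R] = mu [set x | (c <= F x)%R]) ->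
  \int[mu]_x (G x)%:E <= \int[mu]_x (F x)%:E.
Proof.
move=> mG G0 GF.
have sGF m : \int[mu]_x (step_approx m (G x))%:E = \int[mu]_x (step_approx m (F x))%:E.
  by rewrite !integral_step_approx//; apply: eq_bigr => j _; rewrite GF// step_level_gt0.
have [_ sF] := step_approx_dominated.
have := @fatou _ T R mu setT measurableT (fun m x => (step_approx m (G x))%:E)
  (fun m => (measurable_EFinP _ _).2 (measurable_step_approx m mG))
  (fun m x _ => step_approx_ge0 m (G x)).
under [X in _ <= limn_einf X]eq_fun do rewrite sGF.
rewrite (cvg_limn_einf_sup sF).1; apply: le_trans.
rewrite le_eqVlt; apply/orP; left; apply/eqP/eq_integral => x _.
have Gx : (step_approx m (G x))%:E @[m --> \oo] --> (G x)%:E.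
  by apply: cvg_EFin; [exact: nearW|exact: step_approx_cvg].
by rewrite (cvg_limn_einf_sup Gx).1.
Qed.

(** The step integrals of [F] and [G] coincide and are finite, so they can be cancelled from the
    inequality between the full integrals. The bound is uniform over all [G] with the same level
    measures. *)
Lemma equidistributed_step_remainder_le G m : measurable_fun setT G ->
  (forall x, 0 <= G x)%R ->
  (forall c, (0 < c)%R -> mu [set x | (c <= G x)%R] = mu [set x | (c <= F x)%R]) ->
  \int[mu]_x (G x - step_approx m (G x))%:E <=
  \int[mu]_x (F x - step_approx m (F x))%:E.
Proof.
move=> mG G0 GF; have := equidistributed_integral_le mG G0 GF.
rewrite -(integral_step_remainder m mG G0) -(integral_step_remainder m mF F0).
have -> : \int[mu]_x (step_approx m (G x))%:E = \int[mu]_x (step_approx m (F x))%:E.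
  by rewrite !integral_step_approx//; apply: eq_bigr => j _; rewrite GF// step_level_gt0.
rewrite leeD2rE// ge0_fin_numE ?integral_step_approx_lt//.
by apply: integral_ge0 => x _; rewrite lee_fin step_approx_ge0.
Qed.

End Dominated.

(** This integrates the pointwise bound [dist_step_approx_le], in which the comparison of levels
    becomes a distance of indicators. *)
Lemma integral_dist_le_step m F G : measurable_fun setT F -> measurable_fun setT G ->
  (forall x, 0 <= F x)%R -> (forall x, 0 <= G x)%R ->
  \int[mu]_x `|F x - G x|%:E <=
  \int[mu]_x (F x - step_approx m (F x))%:E +
  \int[mu]_x (G x - step_approx m (G x))%:E +
  \sum_(j < m.+1 ^ 2) (m.+1%:R^-1)%:E *
    \int[mu]_x `|\1_[set y | (step_level m j <= F y)%R] x -
                 \1_[set y | (step_level m j <= G y)%R] x|%:E.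
Proof.
move=> mF mG F0 G0.
pose D j x : R := `|\1_[set y | (step_level m j <= F y)%R] x -
                 \1_[set y | (step_level m j <= G y)%R] x|%R.
have mI (H : T -> R) j : measurable_fun setT H ->
    measurable_fun setT (\1_[set y | (step_level m j <= H y)%R] : T -> R).
  by move=> mH; apply: measurable_indic; exact: measurable_ge_set.
have mD j : measurable_fun setT (fun x => (D j x)%:E).
  apply/measurable_EFinP; apply: measurableT_comp => //.
  by apply: measurable_funB; exact: mI.
have mr (H : T -> R) : measurable_fun setT H ->
    measurable_fun setT (fun x => (H x - step_approx m (H x))%:E).
  move=> mH; apply/measurable_EFinP; apply: measurable_funB => //.
  exact: measurable_step_approx.
have r0 (H : T -> R) x : (forall x, 0 <= H x)%R -> 0 <= (H x - step_approx m (H x))%:E.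
  by move=> H0; rewrite lee_fin subr_ge0 step_approx_le.
have D0 (j : 'I_(m.+1 ^ 2)) x : setT x -> 0 <= (m.+1%:R^-1)%:E * (D j x)%:E.
  by move=> _; rewrite -EFinM lee_fin mulr_ge0 ?normr_ge0.
have mE (j : 'I_(m.+1 ^ 2)) : measurable_fun setT (fun x => (m.+1%:R^-1)%:E * (D j x)%:E).
  exact: (measurable_funeM (m.+1%:R^-1)%:E (mD j)).
have -> : \sum_(j < m.+1 ^ 2) (m.+1%:R^-1)%:E * \int[mu]_x (D j x)%:E =
    \int[mu]_x (\sum_(j < m.+1 ^ 2) (m.+1%:R^-1)%:E * (D j x)%:E).
  rewrite (ge0_integral_sum mu measurableT mE D0).
  apply: eq_bigr => j _; rewrite ge0_integralZl_EFin// => x _; rewrite lee_fin; exact: normr_ge0.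
have mS : measurable_fun setT (fun x => \sum_(j < m.+1 ^ 2) (m.+1%:R^-1)%:E * (D j x)%:E).
  exact: emeasurable_sum.
have S0 x : 0 <= \sum_(j < m.+1 ^ 2) (m.+1%:R^-1)%:E * (D j x)%:E.
  by apply: sume_ge0 => j _; exact: D0.
have mFG := emeasurable_funD (mr F mF) (mr G mG).
have FG0 x : setT x -> 0 <= (F x - step_approx m (F x))%:E + (G x - step_approx m (G x))%:E.
  by move=> _; apply: adde_ge0; exact: r0.
rewrite -(ge0_integralD mu measurableT (fun x _ => r0 F x F0) (mr F mF)
   (fun x _ => r0 G x G0) (mr G mG)).
rewrite -(ge0_integralD mu measurableT FG0 mFG (fun x _ => S0 x) mS).
apply: ge0_le_integral => //.
- apply/measurable_EFinP; apply: measurableT_comp => //.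
  exact: measurable_funB.
- exact: emeasurable_funD.
move=> x _; under eq_bigr do rewrite -EFinM; rewrite sumEFin -!EFinD lee_fin.
apply: (le_trans (dist_step_approx_le m (F0 x) (G0 x))).
rewrite lerD2l; apply: ler_sum => j _; rewrite /D.
by have /(congr1 (@^~ x)) /= <- := ind F (step_level m j);
   have /(congr1 (@^~ x)) /= <- := ind G (step_level m j).
Qed.

End StepIntegral.

(** * Convergence to zero of nonnegative extended reals *)

Section ConvergenceToZero.
Context (R : realType).
Implicit Types (u : nat -> \bar R) (r e : R).
Local Open Scope ereal_scope.

Lemma ge0_ecvg0P u : (forall k, 0 <= u k) ->
  u k @[k --> \oo] --> 0 <->
  forall e, (0 < e)%R -> \forall k \near \oo, u k < e%:E.
Proof.
move=> u0; split => [u_0 e e0|h].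
  have /open_ereal_lt' lt0 : 0 < e%:E by rewrite lte_fin.
  exact: u_0 _ lt0.
apply/fine_cvgP; split.
  apply: filterS (h 1%R ltr01) => k uk.
  by rewrite ge0_fin_numE// (lt_trans uk)// ltry.
apply/cvgrPdist_lt => e e0; have := h e e0; apply: filterS => k /= uk.
have ukf : u k \is a fin_num by rewrite ge0_fin_numE// (lt_trans uk)// ltry.
by rewrite sub0r normrN ger0_norm ?fine_ge0// -lte_fin fineK.
Qed.

Lemma poweR_cvg0 u r : (0 < r)%R -> (forall k, 0 <= u k) ->
  u k @[k --> \oo] --> 0 -> (u k `^ r) @[k --> \oo] --> 0.
Proof.
move=> r0 u0 /(ge0_ecvg0P u0) h; apply/ge0_ecvg0P => [k|e e0]; first exact: poweR_ge0.
have er0 : (0 < e `^ r^-1)%R by rewrite powR_gt0.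
apply: filterS (h _ er0) => k; move: (u0 k); case: (u k) => [s| |]//.
rewrite lee_fin lte_fin poweR_EFin lte_fin => s0 se.
rewrite [ltRHS](_ : e = (e `^ r^-1) `^ r)%R; last first.
  by rewrite -powRrM mulVf ?gt_eqF// powRr1// ltW.
by apply: gt0_ltr_powR; rewrite ?nnegrE// ltW.
Qed.

End ConvergenceToZero.

(** * Distances between indicators and between powers of functions *)

Section IndicatorDistance.
Context d (T : measurableType d) (R : realType) (mu : {measure set T -> \bar R}).
Implicit Types A B C : set T.
Local Open Scope ereal_scope.

Lemma measurable_dist_indic A B : measurable A -> measurable B ->
  measurable_fun setT (fun x => (`|\1_A x - \1_B x|%R : R)%:E).
Proof.
move=> mA mB; apply/measurable_EFinP; apply: measurableT_comp => //.
by apply: measurable_funB; exact: measurable_indic.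
Qed.

Lemma integral_dist_indic_triangle A B C :
  measurable A -> measurable B -> measurable C ->
  \int[mu]_x `|\1_A x - \1_C x|%:E <=
  \int[mu]_x `|\1_A x - \1_B x|%:E + \int[mu]_x `|\1_B x - \1_C x|%:E.
Proof.
move=> mA mB mC.
have n0 A' B' (x : T) : setT x -> 0 <= (`|\1_A' x - \1_B' x|%R : R)%:E.
  by move=> _; rewrite lee_fin.
rewrite -(ge0_integralD mu measurableT (n0 A B) (measurable_dist_indic mA mB)
  (n0 B C) (measurable_dist_indic mB mC)).
apply: ge0_le_integral => //.
- exact: measurable_dist_indic.
- by apply: emeasurable_funD; exact: measurable_dist_indic.
- by move=> x _; rewrite -EFinD lee_fin ler_distD.
Qed.

Lemma integral_dist_indic_ae_eq A A' B B' : measurable A -> measurable A' ->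
  measurable B -> measurable B' ->
  {ae mu, forall x, A x <-> A' x} -> {ae mu, forall x, B x <-> B' x} ->
  \int[mu]_x `|\1_A x - \1_B x|%:E = \int[mu]_x `|\1_A' x - \1_B' x|%:E.
Proof.
move=> mA mA' mB mB' AA BB; apply: ge0_ae_eq_integral => //.
- exact: measurable_dist_indic.
- exact: measurable_dist_indic.
- apply: filterS2 AA BB => x Ax Bx _; rewrite !indicE.
  have -> : (x \in A) = (x \in A') by apply/idP/idP => /set_mem/Ax/mem_set.
  by have -> : (x \in B) = (x \in B') by apply/idP/idP => /set_mem/Bx/mem_set.
Qed.

Lemma integral_dist_indic_subset A B : measurable A -> measurable B ->
  {ae mu, forall x, B x -> A x} ->
  \int[mu]_x `|\1_A x - \1_B x|%:E = mu (A `\` B).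
Proof.
move=> mA mB BA.
have mAB : measurable (A `\` B) by exact: measurableD.
rewrite -[A `\` B]setIT -(integral_indic mu measurableT mAB).
apply: ge0_ae_eq_integral => //.
- exact: measurable_dist_indic.
- by apply/measurable_EFinP; exact: measurable_indic.
apply: filterS BA => x BAx _; rewrite !indicE in_setD.
case: (boolP (x \in B)) => [/set_mem/BAx/mem_set ->|_]; first by rewrite subrr normr0.
by rewrite subr0 andbT normr_nat.
Qed.

Lemma integral_indic_powR A (p : R) : (0 < p)%R -> measurable A ->
  \int[mu]_x (`|(\1_A x)%:E| `^ p) = mu A.
Proof.
move=> p0 mA; rewrite -[A in RHS]setIT -(integral_indic mu measurableT mA).
apply: eq_integral => x _ /=; rewrite indicE normr_nat ?poweR_EFin.
by case: (x \in A) => /=; rewrite ?powR1// powR0// gt_eqF.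
Qed.

Lemma markov_powR (p t : R) (f : T -> R) : (0 < p)%R -> (0 < t)%R ->
  (forall x, 0 <= f x)%R -> measurable_fun setT f ->
  (t `^ p)%:E * mu [set x | (t < f x)%R] <= \int[mu]_x (f x `^ p)%:E.
Proof.
move=> p0 t0 f0 mf.
have mt : measurable [set x | (t < f x)%R].
  exact: measurable_gt_set.
rewrite -[X in mu X]setIT -(integral_indic mu measurableT mt).
have mI : measurable_fun setT (EFin \o (\1_[set x | (t < f x)%R] : T -> R)).
  by apply/measurable_EFinP; exact: measurable_indic.
rewrite -ge0_integralZl_EFin//; last exact: powR_ge0.
apply: ge0_le_integral => //.
- by move=> x _; rewrite -EFinM lee_fin mulr_ge0// powR_ge0.
- exact: measurable_funeM.
- by apply/measurable_EFinP; apply: (measurableT_comp (measurable_powR _)).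
move=> x _; rewrite -EFinM lee_fin indicE; case: (boolP (x \in _)) => [/set_mem /= tx|_].
  by rewrite mulr1 ge0_ler_powR ?nnegrE// ltW.
by rewrite mulr0 powR_ge0.
Qed.

Lemma integral_powR_dist_le (p : R) (f g : T -> R) : (1 <= p)%R ->
  measurable_fun setT f -> measurable_fun setT g ->
  (forall x, 0 <= f x)%R -> (forall x, 0 <= g x)%R ->
  \int[mu]_x (`|f x - g x| `^ p)%:E <= \int[mu]_x `|f x `^ p - g x `^ p|%:E.
Proof.
move=> p1 mf mg f0 g0.
have mpow h : measurable_fun setT h -> measurable_fun setT (fun x : T => h x `^ p)%R.
  by move=> mh; exact: (measurableT_comp (measurable_powR _) mh).
apply: ge0_le_integral => //.
- apply/measurable_EFinP; apply: mpow.
  by apply: measurableT_comp => //; exact: measurable_funB.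
- apply/measurable_EFinP; apply: measurableT_comp => //.
  by apply: measurable_funB; exact: mpow.
- by move=> x _; rewrite lee_fin powR_dist_le.
Qed.

(** The difference of two indicators has absolute value 0 or 1, which the power [p] fixes. *)
Lemma integral_dist_powR_ae_indic (p : R) (f g : T -> R) A B : (0 < p)%R ->
  measurable_fun setT f -> measurable_fun setT g ->
  measurable A -> measurable B ->
  {ae mu, forall x, f x = \1_A x} -> {ae mu, forall x, g x = \1_B x} ->
  \int[mu]_x (`|f x - g x| `^ p)%:E = \int[mu]_x `|\1_A x - \1_B x|%:E.
Proof.
move=> p0 mf mg mA mB fA gB; apply: ge0_ae_eq_integral => //.
- apply/measurable_EFinP; apply: (measurableT_comp (measurable_powR _)).
  by apply: measurableT_comp => //; exact: measurable_funB.
- exact: measurable_dist_indic.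
apply: filterS2 fA gB => x -> -> _.
rewrite !indicE; have pN0 : p != 0%R by rewrite gt_eqF.
by do 2 case: (_ \in _) => /=;
  rewrite ?subrr ?subr0 ?sub0r ?normrN ?normr0 ?normr1 ?powR0 ?powR1.
Qed.

Lemma ae_measureD A B : measurable A -> measurable B -> mu A < +oo ->
  {ae mu, forall x, B x -> A x} -> mu (A `\` B) = mu A - mu B.
Proof.
move=> mA mB Aoo BA; rewrite measureD//=; congr (_ - _).
apply: ae_eq_measure => //; first exact: measurableI.
by apply: filterS BA => x BAx; split=> [[]//|Bx]; split=> //; exact: BAx.
Qed.

End IndicatorDistance.

(** * The distances [dset] and [dLp] under rearrangements *)

Section Distances.
Context (R : realType) (n : nat).
Local Notation E := (Leb R n).
Implicit Types (f g u v : E -> R) (A B C : set E).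
Local Open Scope ereal_scope.

Lemma dsetE A B : dset A B = \int[lam]_x `|\1_A x - \1_B x|%:E.
Proof. by rewrite /dset Lnorm1. Qed.

Lemma dset_ge0 A B : 0 <= dset A B.
Proof. exact: Lnorm_ge0. Qed.

Lemma dset_sym A B : dset A B = dset B A.
Proof. by rewrite !dsetE; apply: eq_integral => x _; rewrite distrC. Qed.

Lemma dset_triangle A B C : measurable A -> measurable B -> measurable C ->
  dset A C <= dset A B + dset B C.
Proof. rewrite !dsetE; exact: integral_dist_indic_triangle. Qed.

Lemma dset_ae_eq A A' B B' : measurable A -> measurable A' ->
  measurable B -> measurable B' ->
  {ae lam, forall x, A x <-> A' x} -> {ae lam, forall x, B x <-> B' x} ->
  dset A B = dset A' B'.
Proof. rewrite !dsetE; exact: integral_dist_indic_ae_eq. Qed.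

Lemma dset_subset A B : measurable A -> measurable B ->
  {ae lam, forall x, B x -> A x} -> dset A B = lam (A `\` B).
Proof. rewrite dsetE; exact: integral_dist_indic_subset. Qed.

(** The triangle inequality is taken through the empty set. *)
Lemma dset_le A B : measurable A -> measurable B -> dset A B <= lam A + lam B.
Proof.
move=> mA mB; have m0 : measurable (set0 : set E) by exact: measurable0.
have h C : measurable C -> dset C set0 = lam C.
  by move=> mC; rewrite (dset_subset mC m0 (aeW _ (fun x => False_ind _))) setD0.
by rewrite -(h A mA) -(h B mB) (dset_sym B); exact: dset_triangle.
Qed.

Lemma dLpE (p : R) f g :
  dLp p f g = (\int[lam]_x (`|f x - g x| `^ p)%:E) `^ p^-1.
Proof. by rewrite /dLp unlock. Qed.

(** Removing the outer root lets the estimates work with the integral of the power itself. *)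
Lemma dLp_cvg0 (p : R) (u : nat -> E -> R) v : (0 < p)%R ->
  dLp p (u k) v @[k --> \oo] --> 0 <->
  \int[lam]_x (`|u k x - v x| `^ p)%:E @[k --> \oo] --> 0.
Proof.
move=> p0; set I := fun k => \int[lam]_x (`|u k x - v x| `^ p)%:E.
have I0 k : 0 <= I k by apply: integral_ge0 => x _; rewrite lee_fin powR_ge0.
have -> : (fun k => dLp p (u k) v) = (fun k => I k `^ p^-1).
  by apply/funext => k; rewrite dLpE.
split; last by apply: poweR_cvg0 => //; rewrite invr_gt0.
move=> /(poweR_cvg0 p0 (fun k => poweR_ge0 _ _)).
suff -> : (fun k => (I k `^ p^-1) `^ p) = I by [].
by apply/funext => k; rewrite -poweRrM mulVf ?gt_eqF// poweRe1.
Qed.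

Section OnePair.
Variables S T : (E -> R) -> (E -> R).
Hypotheses (rS : rearrangement S) (rT : rearrangement T).

Lemma diamond_measurable A : Lclass A -> measurable (diamond T A).
Proof. by move=> lA; have [[]] := diamond_Lclass rT lA. Qed.

Lemma dset_diamond_subset A B : Lclass A -> Lclass B -> B `<=` A ->
  dset (diamond T A) (diamond T B) = lam (A `\` B).
Proof.
move=> lA lB BA; have sub := diamond_subset rT lB lA BA.
have [[mDA DAoo] DA] := diamond_Lclass rT lA.
have [[mDB DBoo] DB] := diamond_Lclass rT lB.
rewrite (dset_subset mDA mDB sub) (ae_measureD mDA mDB DAoo sub) DA DB.
have [[mA Aoo] [mB _]] := (lA, lB).
by rewrite (ae_measureD mA mB Aoo (aeW _ BA)).
Qed.

End OnePair.

(** The triangle inequality passes through [diamond S K] and [diamond T K]; each of the two outer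
    steps costs the measure of [A] without [K]. *)
Lemma dset_diamond_approx S T A K : rearrangement S -> rearrangement T ->
  Lclass A -> Lclass K -> K `<=` A ->
  dset (diamond S A) (diamond T A) <=
  dset (diamond S K) (diamond T K) + (lam (A `\` K) + lam (A `\` K)).
Proof.
move=> rS rT lA lK KA.
have m := diamond_measurable.
apply: (le_trans (dset_triangle (m _ rS _ lA) (m _ rS _ lK) (m _ rT _ lA))).
rewrite (dset_diamond_subset rS lA lK KA) addeCA leeD2l//.
apply: (le_trans (dset_triangle (m _ rS _ lK) (m _ rT _ lK) (m _ rT _ lA))).
by rewrite leeD2l// dset_sym (dset_diamond_subset rT lA lK KA).
Qed.

Lemma Lp_plus_indic (p : R) A : (0 < p)%R -> Lclass A -> Lp_plus p (\1_A : E -> R).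
Proof.
move=> p0 [mA Aoo]; split; [by move=> x; rewrite indicE|exact: measurable_indic|].
rewrite unlock; apply: poweR_lty.
by rewrite (integral_indic_powR lam p0 mA).
Qed.

Lemma Lp_plus_powR_lt (p : R) f : (0 < p)%R -> Lp_plus p f ->
  \int[lam]_x (f x `^ p)%:E < +oo.
Proof.
move=> p0 [f0 mf foo]; have pN0 : p != 0%R by rewrite gt_eqF.
have := poweR_Lnorm lam (EFin \o f) pN0.
under [X in _ = X -> _]eq_integral do rewrite /= ger0_norm//.
by move=> <-; exact: poweR_lty.
Qed.

(** By Markov's inequality a level set of infinite measure would make the integral of the power
    infinite. *)
Lemma Lp_plus_inV (p : R) f : (0 < p)%R -> Lp_plus p f -> inV f.
Proof.
move=> p0 fLp; have Foo := Lp_plus_powR_lt p0 fLp.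
have [f0 mf _] := fLp; split => // t t0.
have tp0 : (0 < t `^ p)%R by rewrite powR_gt0.
have := markov_powR lam p0 t0 f0 mf.
move=> h; rewrite ltey; apply/eqP => too; move: h; rewrite too gt0_muley ?lte_fin//.
by rewrite leNgt Foo.
Qed.

Lemma rearrangement_indic_dist (p : R) S T A : (0 < p)%R ->
  rearrangement S -> rearrangement T -> Lclass A ->
  \int[lam]_x (`|S \1_A x - T \1_A x| `^ p)%:E = dset (diamond S A) (diamond T A).
Proof.
move=> p0 rS rT lA; rewrite dsetE.
have mU U : rearrangement U -> measurable_fun setT (U \1_A).
  by move=> [UV _ _]; have [] := UV _ (indic_inV lA).
exact: (integral_dist_powR_ae_indic p0 (mU _ rS) (mU _ rT)
  (diamond_measurable rS lA) (diamond_measurable rT lA)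
  (rearrangement_indic rS lA) (rearrangement_indic rT lA)).
Qed.

End Distances.

(** * Transfer of convergence between functions, sets of finite measure and compact sets *)

Section SequencesOfRearrangements.
Context (R : realType) (n : nat).
Local Notation E := (Leb R n).
Implicit Types (f g : E -> R) (A B : set E) (S T : (E -> R) -> (E -> R)).
Local Open Scope ereal_scope.

Lemma dLp_indic_cvg0 (p : R) (Tk : nat -> (E -> R) -> (E -> R)) T A : (0 < p)%R ->
  (forall k, rearrangement (Tk k)) -> rearrangement T -> Lclass A ->
  dLp p (Tk k \1_A) (T \1_A) @[k --> \oo] --> 0 ->
  dset (diamond (Tk k) A) (diamond T A) @[k --> \oo] --> 0.
Proof.
move=> p0 rTk rT lA /(dLp_cvg0 _ _ p0).
suff -> : (fun k => \int[lam]_x (`|Tk k \1_A x - T \1_A x| `^ p)%:E) =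
  (fun k => dset (diamond (Tk k) A) (diamond T A)) by [].
by apply/funext => k; exact: rearrangement_indic_dist.
Qed.

Section PowerLevels.
Variables (p : R) (f : E -> R).
Hypotheses (p1 : (1 <= p)%R) (fLp : Lp_plus p f).

Let p0 : (0 < p)%R. Proof. exact: lt_le_trans p1. Qed.
Let fV : inV f. Proof. exact: Lp_plus_inV fLp. Qed.

(** For [c > 0] this is also a superlevel set of [f], at the height given by the [p]-th root of [c],
    so the results on [diamond] apply to it. *)
Definition powR_level c : set E := [set y | (c <= f y `^ p)%R].

Lemma powR_levelE g c : (forall x, 0 <= g x)%R -> (0 < c)%R ->
  [set y : E | (c <= g y `^ p)%R] = [set y | (c `^ p^-1 <= g y)%R].
Proof.
by move=> g0 c0; apply/seteqP; split => x /=; rewrite powR_ge_level.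
Qed.

Lemma powR_level_Lclass c : (0 < c)%R -> Lclass (powR_level c).
Proof.
have [f0 _ _] := fV; move=> c0; rewrite /powR_level powR_levelE//.
by apply: ge_level_Lclass => //; exact: powR_gt0.
Qed.

Lemma rearrangement_powR_level T c : rearrangement T -> (0 < c)%R ->
  lam [set y | (c <= T f y `^ p)%R] = lam (powR_level c) /\
  {ae lam, forall x, [set y | (c <= T f y `^ p)%R] x <-> diamond T (powR_level c) x}.
Proof.
move=> rT c0; have [f0 _ _] := fV; have [TV _ _] := rT.
have [Tf0 _ _] := TV _ fV; have cp0 : (0 < c `^ p^-1)%R by exact: powR_gt0.
rewrite /powR_level (powR_levelE Tf0 c0) (powR_levelE f0 c0); split.
  exact: (rearrangement_ge_level rT fV cp0).
exact: (diamond_ge_level rT fV cp0).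
Qed.

Lemma measurable_rearrangement_powR T : rearrangement T ->
  measurable_fun setT (fun x => T f x `^ p)%R.
Proof.
move=> [TV _ _]; have [_ mTf _] := TV _ fV.
exact: (measurableT_comp (measurable_powR _) mTf).
Qed.

(** The two remainders on the right involve [f] alone, so [m] can be fixed before [S] varies. *)
Lemma integral_dist_rearrangements_le S T m : rearrangement S -> rearrangement T ->
  \int[lam]_x (`|S f x - T f x| `^ p)%:E <=
  \int[lam]_x (f x `^ p - step_approx m (f x `^ p))%:E +
  \int[lam]_x (f x `^ p - step_approx m (f x `^ p))%:E +
  \sum_(j < m.+1 ^ 2) (m.+1%:R^-1)%:E *
    dset (diamond S (powR_level (step_level m j)))
         (diamond T (powR_level (step_level m j))).
Proof.
move=> rS rT.
(* Applied to the identity rearrangement, this is measurability of the power of [f] itself. *)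
have mF := measurable_rearrangement_powR (rearrangement_id R n).
have mSf := measurable_rearrangement_powR rS.
have mTf := measurable_rearrangement_powR rT.
have Foo := Lp_plus_powR_lt p0 fLp.
have [Sf0 mSf1 _] : inV (S f) by have [SV _ _] := rS; exact: SV.
have [Tf0 mTf1 _] : inV (T f) by have [TV _ _] := rT; exact: TV.
have pow0 g x : (0 <= g x `^ p)%R by exact: powR_ge0.
have rem U (rU : rearrangement U) := equidistributed_step_remainder_le mF (pow0 f) Foo m
  (measurable_rearrangement_powR rU) (pow0 (U f))
  (fun c c0 => (rearrangement_powR_level rU c0).1).
apply: (@le_trans _ _ (\int[lam]_x `|S f x `^ p - T f x `^ p|%:E)).
  exact: (integral_powR_dist_le lam p1 mSf1 mTf1 Sf0 Tf0).
apply: (le_trans (integral_dist_le_step lam m mSf mTf (pow0 (S f)) (pow0 (T f)))).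
apply: leeD; first by apply: leeD; exact: rem.
apply: lee_sum => j _.
have c0 := @step_level_gt0 R m j.
rewrite -dsetE (dset_ae_eq _ _ _ _ (rearrangement_powR_level rS c0).2
  (rearrangement_powR_level rT c0).2)//.
- exact: measurable_ge_set.
- exact: diamond_measurable (powR_level_Lclass c0).
- exact: measurable_ge_set.
- exact: diamond_measurable (powR_level_Lclass c0).
Qed.

Lemma dset_dLp_cvg0 (Tk : nat -> (E -> R) -> (E -> R)) T :
  (forall k, rearrangement (Tk k)) -> rearrangement T ->
  (forall A, Lclass A -> dset (diamond (Tk k) A) (diamond T A) @[k --> \oo] --> 0) ->
  dLp p (Tk k f) (T f) @[k --> \oo] --> 0.
Proof.
move=> rTk rT cvgL; apply/(dLp_cvg0 _ _ p0)/ge0_ecvg0P => [k|e e0].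
  by apply: integral_ge0 => x _; rewrite lee_fin powR_ge0.
have e30 : (0 < e / 3)%R by rewrite divr_gt0.
have mF := measurable_rearrangement_powR (rearrangement_id R n).
have pow0 x : (0 <= f x `^ p)%R by exact: powR_ge0.
have [rem_cvg _] := step_approx_dominated mF pow0 (Lp_plus_powR_lt p0 fLp).
have rem0 m : 0 <= \int[lam]_x (f x `^ p - step_approx m (f x `^ p))%:E.
  by apply: integral_ge0 => x _; rewrite lee_fin subr_ge0 step_approx_le.
have [m _ /(_ m (leqnn m))/= rem_m] := (ge0_ecvg0P rem0).1 rem_cvg _ e30.
(* There are [(m+1)^2] level sets of weight [1/(m+1)] each, so distances below [eta] contribute at
   most [(m+1) * eta = e / 3]. *)
pose eta : R := (e / 3 / m.+1%:R)%R.
have eta0 : (0 < eta)%R by rewrite divr_gt0.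
have near_j : \forall k \near \oo, forall j : 'I_(m.+1 ^ 2),
    dset (diamond (Tk k) (powR_level (step_level m j)))
         (diamond T (powR_level (step_level m j))) < eta%:E.
  apply: filter_forall => j.
  have lA := powR_level_Lclass (@step_level_gt0 R m j).
  exact: ((ge0_ecvg0P (fun k => dset_ge0 _ _)).1 (cvgL _ lA) _ eta0).
apply: filterS near_j => k hk.
apply: (le_lt_trans (integral_dist_rearrangements_le m (rTk k) rT)).
apply: (@le_lt_trans _ _ (\int[lam]_x (f x `^ p - step_approx m (f x `^ p))%:E +
  \int[lam]_x (f x `^ p - step_approx m (f x `^ p))%:E + (e / 3)%:E)).
  apply: leeD2l; apply: (@le_trans _ _ (\sum_(j < m.+1 ^ 2) (m.+1%:R^-1)%:E * eta%:E)).
    by apply: lee_sum => j _; rewrite lee_pmul2l ?ltW// ?lte_fin ?invr_gt0.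
  under eq_bigr do rewrite -EFinM; rewrite sumEFin lee_fin sumr_const card_ord.
  rewrite -[leLHS]mulr_natr natrX /eta [leLHS](_ : _ = e / 3)%R//; field.
  by rewrite ?natr1 ?nat1r pnatr_eq0.
have -> : e%:E = (e / 3)%:E + (e / 3)%:E + (e / 3)%:E.
  by rewrite -!EFinD; congr EFin; field.
by rewrite lteD2rE// lteD.
Qed.

End PowerLevels.

Lemma compact_subset_Cclass A e : Lclass A -> A !=set0 -> (0 < e)%R ->
  exists K : set E, [/\ Cclass K, K `<=` A & lam (A `\` K) < e%:E].
Proof.
move=> lA [a Aa] e0; have [K [cK KA Ke]] := compact_subset_approx lA e0.
(* [Cclass] excludes the empty set. If [K] is empty, then [A] itself has measure below [e] and a
   singleton in [A] serves instead. *)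
have [K0|/set0P K0] := eqVneq K set0; last by exists K; split.
have c1 : @compact 'rV[R]_n [set a] by exact: compact_set1.
exists [set a]; split.
- by split; [exists a|exact: c1].
- by move=> _ ->.
apply: le_lt_trans Ke; rewrite K0 setD0; apply: le_measure; rewrite ?inE.
- by apply: measurableD; [case: lA|case: (compact_Lclass c1)].
- by case: lA.
- exact: subDsetl.
Qed.

Lemma Cclass_Lclass A : Cclass A -> Lclass A.
Proof. by move=> [_]; exact: compact_Lclass. Qed.

(** This settles the empty set, which has no subset in [Cclass]. *)
Lemma dset_diamond_empty S T A : rearrangement S -> rearrangement T ->
  Lclass A -> ~ (A !=set0) -> dset (diamond S A) (diamond T A) = 0.
Proof.
move=> rS rT lA A0; have A00 : A = set0.
  by rewrite -subset0 => x Ax; apply: A0; exists x.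
have lam0 U : rearrangement U -> lam (diamond U A) = 0.
  by move=> rU; have [_ ->] := diamond_Lclass rU lA; rewrite A00 measure0.
apply/eqP; rewrite eq_le dset_ge0 andbT.
have := dset_le (diamond_measurable rS lA) (diamond_measurable rT lA).
by rewrite (lam0 _ rS) (lam0 _ rT) adde0.
Qed.

(** [K] is chosen before [S]: one compact set serves a whole sequence, and in the weak case [S] may
    be picked to suit [K]. *)
Lemma dset_diamond_approx_lt T A e : rearrangement T -> Lclass A -> A !=set0 ->
  (0 < e)%R -> exists K, Cclass K /\ forall S, rearrangement S ->
    dset (diamond S K) (diamond T K) < (e / 3)%:E ->
    dset (diamond S A) (diamond T A) < e%:E.
Proof.
move=> rT lA A0 e0; have e30 : (0 < e / 3)%R by rewrite divr_gt0.
have [K [cK KA AKe]] := compact_subset_Cclass lA A0 e30.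
exists K; split=> // S rS SKe.
apply: (le_lt_trans (dset_diamond_approx rS rT lA (Cclass_Lclass cK) KA)).
have -> : e%:E = (e / 3)%:E + ((e / 3)%:E + (e / 3)%:E).
  by rewrite -!EFinD; congr EFin; field.
by apply: lteD => //; exact: lteD.
Qed.

Lemma dset_cvg0_Cclass_Lclass (Tk : nat -> (E -> R) -> (E -> R)) T :
  (forall k, rearrangement (Tk k)) -> rearrangement T ->
  (forall A, Cclass A -> dset (diamond (Tk k) A) (diamond T A) @[k --> \oo] --> 0) ->
  forall A, Lclass A -> dset (diamond (Tk k) A) (diamond T A) @[k --> \oo] --> 0.
Proof.
move=> rTk rT cvgC A lA; have [A0|A0] := pselect (A !=set0); last first.
  under eq_fun do rewrite (dset_diamond_empty (rTk _) rT lA A0).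
  exact: cvg_cst.
apply/(ge0_ecvg0P (fun k => dset_ge0 _ _)) => e e0.
have [K [cK KA]] := dset_diamond_approx_lt rT lA A0 e0.
have e30 : (0 < e / 3)%R by rewrite divr_gt0.
have := (ge0_ecvg0P (fun k => dset_ge0 _ _)).1 (cvgC K cK) _ e30.
by apply: filterS => k; exact: KA.
Qed.

Lemma dset_compn_diamond (S : nat -> (E -> R) -> (E -> R)) T k A :
  (forall k, rearrangement (S k)) -> rearrangement T -> Lclass A ->
  dset (compn (fun k => diamond (S k)) k A) (diamond T A) =
  dset (diamond (compn S k) A) (diamond T A).
Proof.
move=> rS rT lA; have [[mA _] eqA] := compn_diamond k rS lA.
have mT := diamond_measurable rT lA.
apply: (dset_ae_eq mA (diamond_measurable (compn_rearrangement k rS) lA) mT mT eqA).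
exact: filterE.
Qed.

(** * Approximation by the set maps induced by a family *)

Section Families.
Variable W : set ((E -> R) -> (E -> R)).
Local Notation dW := [set diamond S | S in W].

Lemma choose_diamonds (D : nat -> set E -> set E) : (forall k, dW (D k)) ->
  exists Tk : nat -> (E -> R) -> (E -> R),
    (forall k, W (Tk k)) /\ D = (fun k => diamond (Tk k)).
Proof.
move=> dWD; have ex k : exists S, W S /\ diamond S = D k.
  by have [S WS SD] := dWD k; exists S.
have [Tk TkP] := choice ex.
exists Tk; split=> [k|]; first by have [] := TkP k.
by apply/funext => k; have [_ ->] := TkP k.
Qed.

Lemma approximable_diamondP X T :
  approximable dset X dW (diamond T) <->
  exists Tk, (forall k, W (Tk k)) /\ forall A, X A ->
    dset (diamond (Tk k) A) (diamond T A) @[k --> \oo] --> 0.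
Proof.
split=> [[D [/choose_diamonds[Tk [WTk ->]] cvgD]]|[Tk [WTk cvgT]]].
  by exists Tk.
by exists (fun k => diamond (Tk k)); split=> // k; exists (Tk k).
Qed.

Hypothesis rW : forall S, W S -> rearrangement S.

(** The left side composes set maps and the right side takes the set map of a composition; these
    agree a.e. on [Lclass], so the distances are equal. *)
Lemma seq_approximable_diamondP X T : rearrangement T -> X `<=` Lclass ->
  seq_approximable dset X dW (diamond T) <->
  exists S : nat -> (E -> R) -> (E -> R), (forall k, W (S k)) /\ forall A, X A ->
    dset (diamond (compn S k.+1) A) (diamond T A) @[k --> \oo] --> 0.
Proof.
move=> rT XL.
have E1 (S : nat -> (E -> R) -> (E -> R)) A : (forall k, W (S k)) -> X A ->
    (fun k => dset (compn (fun k => diamond (S k)) k.+1 A) (diamond T A)) =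
    (fun k => dset (diamond (compn S k.+1) A) (diamond T A)).
  move=> WS XA; apply/funext => k.
  by apply: dset_compn_diamond => //; [move=> ?; exact: rW|exact: XL].
split=> [[D [/choose_diamonds[S [WS ->]] cvgD]]|[S [WS cvgS]]].
  by exists S; split=> // A XA; rewrite -E1//; exact: cvgD.
exists (fun k => diamond (S k)); split=> [k|A XA]; first by exists (S k).
by rewrite E1//; exact: cvgS.
Qed.

(** The sequence for a compact set depends on that set, so it cannot be reused as the compact sets
    vary with the accuracy. One map is picked for each accuracy [1/(k+1)]. *)
Lemma weakly_approximable_Lclass T : rearrangement T ->
  weakly_approximable dset Cclass dW (diamond T) ->
  weakly_approximable dset Lclass dW (diamond T).
Proof.
move=> rT wC A lA.
have near_id K e : Cclass K -> (0 < e)%R ->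
    exists2 S, W S & dset (diamond S K) (diamond T K) < e%:E.
  move=> cK e0; have [D [/choose_diamonds[Tk [WTk ->]] cvgT]] := wC K cK.
  have [N _ /(_ N (leqnn N))/= h] :=
    (ge0_ecvg0P (fun k => dset_ge0 _ _)).1 cvgT _ e0.
  by exists (Tk N).
have ex (k : nat) : exists S, W S /\
    dset (diamond S A) (diamond T A) < (k.+1%:R^-1)%:E.
  have e0 : (0 < k.+1%:R^-1 :> R)%R by rewrite invr_gt0.
  have [A0|A0] := pselect (A !=set0).
    have [K [cK KA]] := dset_diamond_approx_lt rT lA A0 e0.
    have [S WS SK] := near_id K _ cK (divr_gt0 e0 (ltr0n R 3)).
    by exists S; split=> //; apply: KA => //; exact: rW.
  (* For empty [A] any member of [W] works; applying the hypothesis to a singleton shows that there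
     is one. *)
  have c1 : Cclass ([set 0%R] : set E).
    by split; [exists 0%R|exact: (@compact_set1 'rV[R]_n)].
  have [S WS _] := near_id _ _ c1 ltr01.
  by exists S; split=> //; rewrite (dset_diamond_empty (rW WS) rT lA A0) lte_fin.
have [Tk TkP] := choice ex.
exists (fun k => diamond (Tk k)); split=> [k|].
  by exists (Tk k) => //; have [] := TkP k.
apply/(ge0_ecvg0P (fun k => dset_ge0 _ _)) => e e0.
have [N _ hN] := near_infty_natSinv_lt (PosNum e0).
exists N => // k /hN /= ke; have [_ /lt_trans] := TkP k; apply.
by rewrite lte_fin.
Qed.

End Families.
End SequencesOfRearrangements.

(** * The equivalences for the three notions of approximation *)

Theorem theorem5p2 (R : realType) (n : nat) (p : R)
  (T : (Leb R n -> R) -> (Leb R n -> R))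
  (W : set ((Leb R n -> R) -> (Leb R n -> R))) :
  (0 < n)%N -> 1 <= p ->
  rearrangement T -> (forall S, W S -> rearrangement S) ->
  let dW := [set diamond S | S in W] in
  [/\ (* approximable *)
      (approximable (dLp p) (Lp_plus p) W T <->
         approximable dset Lclass dW (diamond T))
    , (approximable dset Lclass dW (diamond T) <->
         approximable dset Cclass dW (diamond T))
      (* sequentially approximable *)
    , (seq_approximable (dLp p) (Lp_plus p) W T <->
         seq_approximable dset Lclass dW (diamond T))
    , (seq_approximable dset Lclass dW (diamond T) <->
         seq_approximable dset Cclass dW (diamond T))
      (* weakly approximable: (i) -> (ii) <-> (iii) *)
    & (weakly_approximable (dLp p) (Lp_plus p) W T ->
         weakly_approximable dset Lclass dW (diamond T))
      /\ (weakly_approximable dset Lclass dW (diamond T) <->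
         weakly_approximable dset Cclass dW (diamond T))].
Proof.
move=> _ p1 rT rW dW; have p0 : 0 < p by exact: lt_le_trans p1.
have rS (S : nat -> _) : (forall k, W (S k)) -> forall k, rearrangement (S k).
  by move=> WS k; exact: rW.
(* The index [k.+1] matches sequential approximation, whose first term is one map and not the empty
   composition. *)
have rC (S : nat -> _) (WS : forall k, W (S k)) k := compn_rearrangement k.+1 (rS S WS).
have CL : @Cclass R n `<=` Lclass by move=> A; exact: Cclass_Lclass.
have LL : @Lclass R n `<=` Lclass by [].
(* Indicators of sets in [Lclass] are admissible functions, so passing from functions to sets is a
   restriction to them. *)
have Lp_ind A := @Lp_plus_indic R n p A p0.
split.
- split=> [[Tk [WTk h]]|/approximable_diamondP[Tk [WTk h]]].
    apply/approximable_diamondP; exists Tk; split=> // A lA.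
    exact: dLp_indic_cvg0 p0 (rS _ WTk) rT lA (h _ (Lp_ind _ lA)).
  exists Tk; split=> // f fLp; exact: (dset_dLp_cvg0 p1 fLp (rS _ WTk) rT h).
- split=> /approximable_diamondP[Tk [WTk h]]; apply/approximable_diamondP;
    exists Tk; split=> //.
    by move=> A /CL; exact: h.
  exact: dset_cvg0_Cclass_Lclass (rS _ WTk) rT h.
- split=> [[S [WS h]]|/(seq_approximable_diamondP rW rT LL)[S [WS h]]].
    apply/(seq_approximable_diamondP rW rT LL); exists S; split=> // A lA.
    exact: dLp_indic_cvg0 p0 (rC _ WS) rT lA (h _ (Lp_ind _ lA)).
  exists S; split=> // f fLp; exact: (dset_dLp_cvg0 p1 fLp (rC _ WS) rT h).
- split=> [/(seq_approximable_diamondP rW rT LL)|/(seq_approximable_diamondP rW rT CL)];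
    move=> [S [WS h]].
    by apply/(seq_approximable_diamondP rW rT CL); exists S; split=> // A /CL; exact: h.
  apply/(seq_approximable_diamondP rW rT LL); exists S; split=> //.
  exact: dset_cvg0_Cclass_Lclass (rC _ WS) rT h.
(* In the weak case the sequence found for the indicator of [A] serves for [A]. *)
- split=> [h A lA|]; last first.
    by split=> [h A /CL|]; [exact: h|exact: weakly_approximable_Lclass].
  have [Tk [WTk hk]] := h _ (Lp_ind _ lA).
  exists (fun k => diamond (Tk k)); split=> [k|]; first by exists (Tk k).
  exact: dLp_indic_cvg0 p0 (rS _ WTk) rT lA hk.
Qed.
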